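(* Let $q$ be a prime power. The group $L_2(q)$ admits a strongly real Beauville structure if and only if $q>5$.
   Context: $L_2(q)=PSL_2(q)=SL_2(q)/\{\pm I\}$, where $SL_2(q)$ is the group of $2\times 2$ matrices of determinant $1$ over the finite field $F_q$ with $q$ elements. A (unmixed) Beauville structure for a finite group $G$ is a pair of triples $(x_i,y_i,z_i)$ ($i=1,2$) of elements of $G$, each of which generates $G$, of orders $(l_i,m_i,n_i)$ (i.e. $x_i,y_i,z_i$ have orders $l_i,m_i,n_i$ respectively), such that: (1) $x_iy_iz_i=1$ for each $i=1,2$; (2) $l_i^{-1}+m_i^{-1}+n_i^{-1}<1$ for each $i=1,2$; (3) no non-identity power of $x_1$, $y_1$ or $z_1$ is conjugate in $G$ to a power of $x_2$, $y_2$ or $z_2$. A Beauville structure $(x_i,y_i,z_i)$, $i=1,2$, on $G$ is strongly real if there are automorphisms $\alpha_1,\alpha_2$ of $G$, differing by an inner automorphism of $G$, such that for each $i=1,2$ the automorphism $\alpha_i$ inverts two elements of the triple $(x_i,y_i,z_i)$ (that is, sends each of two of the three entries to its inverse). *)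

(* Defs.v *)
From mathcomp Require Import all_boot all_order all_algebra all_fingroup.

Set Implicit Arguments.
Unset Strict Implicit.
Unset Printing Implicit Defensive.

Import GRing.Theory Num.Theory.

Local Open Scope group_scope.

Section Beauville.

Variable gT : finGroupType.
Implicit Types (G : {group gT}) (x y z : gT) (alpha : {perm gT}).

(* Generation forces x, y and z to lie in G. *)
Definition hyperbolic_generating_triple G x y z : Prop :=
  [/\ <<[set x; y; z]>> = G :> {set gT},
      x * y * z = 1
    & ((#[x]%:R^-1 + #[y]%:R^-1 + #[z]%:R^-1 < 1 :> rat)%R)].

(* Natural exponents suffice: in a finite group every power of an element is
   one with a natural exponent. *)
Definition nonconjugate_powers G (A B : {set gT}) : Prop :=
  forall a b (i j : nat), a \in A -> b \in B -> a ^+ i != 1 ->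
    b ^+ j \notin (a ^+ i) ^: G.

Definition beauville_structure G x1 y1 z1 x2 y2 z2 : Prop :=
  [/\ hyperbolic_generating_triple G x1 y1 z1,
      hyperbolic_generating_triple G x2 y2 z2
    & nonconjugate_powers G [set x1; y1; z1] [set x2; y2; z2]].

Definition inverts_two alpha x y z : Prop :=
  [\/ alpha x = x^-1 /\ alpha y = y^-1,
      alpha x = x^-1 /\ alpha z = z^-1
    | alpha y = y^-1 /\ alpha z = z^-1].

(* conj_aut G @* G is the group of inner automorphisms of G; it is normal in
   Aut G, so the side on which alpha1 and alpha2 are compared is immaterial. *)
Definition strongly_real G x1 y1 z1 x2 y2 z2 : Prop :=
  exists alpha1 alpha2 : {perm gT},
    [/\ alpha1 \in Aut G, alpha2 \in Aut G,
        alpha1^-1 * alpha2 \in conj_aut G @* G,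
        inverts_two alpha1 x1 y1 z1
      & inverts_two alpha2 x2 y2 z2].

Definition admits_strongly_real_beauville G : Prop :=
  exists x1 y1 z1 x2 y2 z2 : gT,
    beauville_structure G x1 y1 z1 x2 y2 z2 /\
    strongly_real G x1 y1 z1 x2 y2 z2.

End Beauville.

Section L2.

Variable F : finFieldType.

Definition SL2 : {set {'GL_2[F]}} :=
  [set u | (\det (GLval u) == 1)%R].

Lemma SL2_group_set : group_set SL2.
Proof.
apply/group_setP; split=> [|u v]; first by rewrite inE GL_1E det1.
by rewrite !inE GL_ME det_mulmx => /eqP-> /eqP->; rewrite mulr1.
Qed.
Canonical SL2_group := Group SL2_group_set.

(* The subgroup {I, -I}, trivial in characteristic 2. *)
Definition pmI : {set {'GL_2[F]}} :=
  [set u | (GLval u == 1%:M)%R || (GLval u == - 1%:M)%R].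

Lemma pmI_group_set : group_set pmI.
Proof.
apply/group_setP; split=> [|u v]; first by rewrite inE GL_1E eqxx.
rewrite !inE GL_ME => /orP[]/eqP-> /orP[]/eqP->;
  by rewrite ?mulrNN ?mulrN ?mulNr mulr1 eqxx ?orbT.
Qed.
Canonical pmI_group := Group pmI_group_set.

Lemma pmI_normal : pmI <| SL2.
Proof.
apply/andP; split.
  apply/subsetP=> u; rewrite !inE => /orP[]/eqP->; first by rewrite det1.
  by rewrite -scaleN1r detZ det1 mulr1 sqrrN expr1n.
apply: cents_norm; apply/centsP=> v _ u; rewrite inE => uI.
apply: val_inj; rewrite [LHS]GL_ME [RHS]GL_ME.
by case/orP: uI => /eqP->; rewrite ?mulNr ?mulrN ?mul1r ?mulr1.
Qed.

Definition L2 : {group coset_of pmI} := [group of SL2 / pmI].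

End L2.

(* Main.v *)
Require Import Defs.
From mathcomp Require Import all_boot all_order all_algebra all_fingroup.
From mathcomp Require Import all_solvable all_field.
From mathcomp Require Import ring zify lra.

(** Write q for the order of F, p for its characteristic and d for
    gcd(2, q - 1).

    If q <= 5, every t in F is a root of t (t^2 - 1) (t^4 - 3 t^2 + 1).  The
    three factors are the coefficients of g in g^2, g^3 and g^5 when g has
    determinant 1 and trace t, so every element of L2 has order 1, 2, 3 or 5
    ([small_trace]).  A hyperbolic triple cannot have all its orders at most
    3, so each of two triples contains an element of order 5; as 25 does not
    divide the order of the group, Sylow's theorem makes the two subgroups
    generated by these elements conjugate ([not_beauville_small]).

    If q >= 8 and q <> 9, the two triples live on different tori.  The first
    one consists of images of matrices diagonalizable over F, whose orders
    divide (q - 1)/d; the second one is made of two elements of the nonsplit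
    torus and a unipotent element, whose orders divide p (q + 1)/d.  These
    exponents are coprime, so no nontrivial powers can be conjugate.  A
    traceless J such that J X is traceless conjugates X to its inverse; both
    triples are chosen so that such a J of determinant -1 exists, and two
    conjugations by matrices of equal determinant differ by an inner
    automorphism ([admits_of_gen_triples]).

    Generation is proved directly, without the list of subgroups of L2.
    - In the split case the first generator is diag(a, 1/a) with a a generator
      of the multiplicative group, and the second one is y = (r, w; -w, u).
      This symmetric shape, needed for strong reality, asks for a point on a
      conic ([exists_square_discriminant]).  It also allows a diagonal D for
      which y D y has exactly one zero on its diagonal; such a matrix moves
      only one of the two fixed points of the torus onto the other, so that it
      conjugates the torus to triangular matrices, whence transvections
      ([full_split]).
    - In the nonsplit case the subgroup K contains a transvection, so the
      additive group V of the v with (1, v; 0, 1) in K is not 0; let R be the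
      ring of the r with r V contained in V.  The nonsplit torus acts
      transitively on vectors of given norm; hence if two elements of K have
      first columns whose norms differ by a square k^2, then K contains an
      upper triangular matrix with diagonal (k, 1/k), and k^2 is in R
      ([column_norm_ratio]).  Comparing a few explicit norms, two of which
      must lie in the same square class, puts the square of the trace s of a
      generator of the torus in R, and s^2 generates the field F
      ([subring_full]).  So R = F, hence V = F.

    For q = 7 the orders (q - 1)/2 are too small, and for q = 9 the subgroup
    generated by the second triple is the alternating group of degree 5.  In
    these two cases explicit triples of types (7, 7, 7) and (4, 4, 4),
    respectively (4, 4, 4) and (5, 5, 5), are exhibited. *)

Set Implicit Arguments.
Unset Strict Implicit.
Unset Printing Implicit Defensive.
Import GRing.Theory.
Local Open Scope ring_scope.

(** * Subgroups of SL2 as predicates on matrix entries *)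

(** The cofactor [k] turns an equation that follows linearly from one
    hypothesis into a polynomial or rational identity. *)
Lemma eq_from_scaled_eq (F : comPzRingType) (k e f a b : F) :
  e = f -> a - b = k * (e - f) -> a = b.
Proof. by move=> -> /eqP; rewrite subrr mulr0 subr_eq0 => /eqP. Qed.

(** The same device for computations in characteristic dividing [m]. *)
Lemma eq_of_natr0 (F : idomainType) (m : nat) (c a b : F) :
  m%:R = 0 :> F -> a - b = m%:R * c -> a = b.
Proof. by move=> ->; rewrite mul0r => /eqP; rewrite subr_eq0 => /eqP. Qed.

Lemma char2_sqrt (F : finFieldType) : 2%:R = 0 :> F ->
  forall x : F, exists k, x = k ^+ 2.
Proof.
move=> two0 x; have inj : injective (fun k : F => k ^+ 2).
  move=> a b /eqP; rewrite -subr_eq0 => /eqP E; apply/eqP.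
  rewrite -subr_eq0 -sqrf_eq0; apply/eqP.
  have -> : (a - b) ^+ 2 = a ^+ 2 - b ^+ 2 + 2%:R * (b * (b - a)) by ring.
  by rewrite E two0 mul0r addr0.
by exists (invF inj x); rewrite (f_invF inj).
Qed.

Section SubgroupPredicate.
Variable F : finFieldType.
Implicit Type P : F -> F -> F -> F -> bool.

(** [P a b c d] stands for membership of the matrix (a, b; c, d) in a subgroup
    of SL2.  Working with the four entries turns every computation in the
    group into polynomial identities over F. *)
Record subgroup_pred P : Prop := SubgroupPred {
  sgp1 : P 1 0 0 1;
  sgp_det : forall a b c d, P a b c d -> a * d - b * c = 1;
  sgpV : forall a b c d, P a b c d -> P d (- b) (- c) a;
  sgpM : forall a b c d a' b' c' d', P a b c d -> P a' b' c' d' ->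
    P (a * a' + b * c') (a * b' + b * d') (c * a' + d * c') (c * b' + d * d')
}.

Definition full_pred P := forall a b c d, a * d - b * c = 1 -> P a b c d.

Variables (P : F -> F -> F -> F -> bool) (Psub : subgroup_pred P).

Lemma eq_sgp a b c d a' b' c' d' : P a b c d ->
  a = a' -> b = b' -> c = c' -> d = d' -> P a' b' c' d'.
Proof. by move=> Pm <- <- <- <-. Qed.

(** The additive group called V in the introduction. *)
Definition uppers : {pred F} := [pred v | P 1 v 0 1].

Lemma uppers0 : 0 \in uppers.
Proof. by rewrite inE (sgp1 Psub). Qed.

Lemma uppersN v : v \in uppers -> - v \in uppers.
Proof.
by rewrite !inE => /(sgpV Psub)/eq_sgp; apply=> //; rewrite oppr0.
Qed.

Lemma uppersD v w : v \in uppers -> w \in uppers -> v + w \in uppers.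
Proof.
by rewrite !inE => Pv Pw; apply: (eq_sgp (sgpM Psub Pv Pw)); ring.
Qed.

Lemma uppersMn v n : v \in uppers -> v *+ n \in uppers.
Proof.
move=> Vv; elim: n => [|n IH]; first by rewrite mulr0n uppers0.
by rewrite mulrS uppersD.
Qed.

Lemma uppers_scale k m v : k != 0 -> P k m 0 k^-1 ->
  v \in uppers -> k ^+ 2 * v \in uppers.
Proof.
rewrite !inE => k0 Pk Pv.
by apply: (eq_sgp (sgpM Psub (sgpM Psub Pk Pv) (sgpV Psub Pk))); field.
Qed.

(** Multiplying a matrix with lower left entry [t <> 0] on both sides by upper
    transvections produces the antidiagonal (0, -1/t; t, 0); this conjugates
    upper transvections to lower ones, and the two kinds generate SL2. *)
Lemma full_of_uppers r s t u : (forall v, v \in uppers) -> P r s t u ->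
  t != 0 -> full_pred P.
Proof.
move=> allU Pm t0.
have detm := sgp_det Psub Pm.
have PU v : P 1 v 0 1 by have:= allU v; rewrite inE.
have Pw : P 0 (- t^-1) t 0.
  apply: (eq_sgp (sgpM Psub (sgpM Psub (PU (- r / t)) Pm) (PU (- u / t)))).
  - by field.
  - by apply: (eq_from_scaled_eq (k := - t^-1) detm); field.
  - by ring.
  - by field.
have PL m : P 1 0 m 1.
  apply: (eq_sgp (sgpM Psub (sgpM Psub Pw (PU (- m / t ^+ 2))) (sgpV Psub Pw)));
    by field.
have Pbig a b c d : c != 0 -> a * d - b * c = 1 -> P a b c d.
  move=> c0 det1.
  apply: (eq_sgp (sgpM Psub (sgpM Psub (PU ((a - 1) / c)) (PL c))
                            (PU ((d - 1) / c)))).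
  - by field.
  - by apply: (eq_from_scaled_eq (k := c^-1) det1); field.
  - by ring.
  - by field.
move=> a b c d det1; have [c0|/Pbig] := eqVneq c 0; last exact.
have a0 : a != 0.
  by apply: contra_eq_neq det1 => ->; rewrite c0 !(mul0r, mulr0) subr0 eq_sym oner_eq0.
have Pac : P a b (a + c) (b + d).
  by apply: Pbig; [rewrite c0 addr0 | rewrite -det1; ring].
by apply: (eq_sgp (sgpM Psub (PL (-1)) Pac)); ring.
Qed.

(** Every element of F is a difference of two squares, or a square in
    characteristic 2. *)
Lemma uppers_full_of_squares v : v != 0 -> v \in uppers ->
  (forall k x, k != 0 -> x \in uppers -> k ^+ 2 * x \in uppers) ->
  forall x, x \in uppers.
Proof.
move=> v0 Vv Vsq.
have Vsq0 k x : x \in uppers -> k ^+ 2 * x \in uppers.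
  by move=> Vx; have [->|/Vsq] := eqVneq k 0; [rewrite expr0n mul0r uppers0 | exact].
move=> x; have [two0|two0] := eqVneq (2%:R : F) 0; last first.
  suff -> : x = ((x / v + 1) / 2%:R) ^+ 2 * v - ((x / v - 1) / 2%:R) ^+ 2 * v.
    by rewrite uppersD ?uppersN ?Vsq0.
  by field; apply/andP.
have [k Ek] := char2_sqrt two0 (x / v).
by rewrite -[x](divfK v0) Ek Vsq0.
Qed.

(** The matrix [g = (r, s; t, 0)] sends the fixed line of the torus spanned by
    the second basis vector to the other fixed line, but not conversely.  So
    [g D g^-1] with [D] diagonal is upper triangular and not diagonal, and a
    diagonal factor makes it a transvection. *)
Lemma full_of_torus r s t : (forall k, k != 0 -> P k 0 0 k^-1) ->
  P r s t 0 -> r != 0 -> (exists2 k : F, k != 0 & k ^+ 2 != 1) -> full_pred P.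
Proof.
move=> PT Pm r0 [k k0 k1].
have detm := sgp_det Psub Pm.
have t0 : t != 0.
  by apply: contra_eq_neq detm => ->; rewrite !mulr0 subr0 eq_sym oner_eq0.
have s0 : s != 0.
  by apply: contra_eq_neq detm => ->; rewrite mulr0 mul0r subr0 eq_sym oner_eq0.
have Es : s = - t^-1.
  by apply: (eq_from_scaled_eq (k := - t^-1) detm); field.
set v := r * s * (k ^- 2 - 1).
have Vv : v \in uppers.
  rewrite inE.
  have PA := sgpM Psub Pm (PT k k0).
  have PB := sgpM Psub (sgpM Psub PA (sgpV Psub Pm)) (PT k k0).
  by apply: (eq_sgp PB); rewrite /v Es; field; rewrite k0 t0.
apply: (full_of_uppers _ Pm t0).
apply: uppers_full_of_squares Vv _.
  rewrite /v !mulf_neq0 // subr_eq0.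
  by apply: contra k1 => /eqP E; rewrite -[k ^+ 2]invrK E invr1.
by move=> l x l0; exact: (uppers_scale l0 (PT l l0)).
Qed.

(** With [D = diag(u/w, w/u)] the product [y D y] has lower right entry 0 and
    upper left entry [(r u - w^2)/(u w)], because [r u + w^2 = 1]; so
    [full_of_torus] applies unless [r u = w^2].  In that case [r u = w^2 = 1/2],
    which happens for the octahedral group; replacing [y] by [y D y] with
    [D = diag(k u/w, w/(k u))] leaves this situation as soon as [k^8 <> 1]. *)
Lemma full_split r u w : (forall k, k != 0 -> P k 0 0 k^-1) ->
  P r w (- w) u -> w != 0 -> r + u != 0 ->
  (exists2 k : F, k != 0 & k ^+ 8 != 1) -> full_pred P.
Proof.
move=> PT Pm w0 tr0 [k k0 k8].
have k2 : k ^+ 2 != 1 by apply: contra k8 => /eqP E; rewrite (exprM k 2 4) E expr1n.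
have k4 : k ^+ 4 != 1 by apply: contra k8 => /eqP E; rewrite (exprM k 4 2) E expr1n.
have exk : exists2 k : F, k != 0 & k ^+ 2 != 1 by exists k.
have core r' u' w' : P r' w' (- w') u' -> w' != 0 -> r' != 0 ->
    r' * u' != w' ^+ 2 -> full_pred P.
  move=> Pm' w0' r0' ruw; have detm := sgp_det Psub Pm'.
  have [u0|u0] := eqVneq u' 0.
    by rewrite u0 in Pm'; exact: full_of_torus PT Pm' r0' exk.
  have := sgpM Psub (sgpM Psub Pm' (PT (u' / w') _)) Pm'.
  rewrite mulf_neq0 ?invr_neq0 // => /(_ isT) Pyy.
  pose rr := (r' * u' - w' ^+ 2) / (u' * w').
  have nrr : rr != 0 by rewrite mulf_neq0 ?invr_neq0 ?subr_eq0 ?mulf_neq0.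
  have Er : r' = (1 - w' ^+ 2) / u'.
    by apply: (eq_from_scaled_eq (k := u'^-1) detm); field.
  eapply full_of_torus; [exact: PT| |exact: nrr|exact: exk].
  apply: (eq_sgp Pyy).
  - by rewrite /rr Er; field; rewrite u0 w0'.
  - reflexivity.
  - reflexivity.
  - by field; rewrite u0 w0'.
have [ruw|ruw] := eqVneq (r * u) (w ^+ 2); last first.
  have [r0|r0] := eqVneq r 0; last exact: core Pm w0 r0 ruw.
  apply: (core u r (- w)); rewrite ?opprK ?oppr_eq0 //.
  - by apply: (eq_sgp (sgpV Psub Pm)); rewrite ?opprK.
  - by rewrite r0 add0r in tr0.
  - by rewrite mulrC sqrrN.
have detm := sgp_det Psub Pm.
have w2 : 2%:R * w ^+ 2 = 1 by rewrite -[RHS]detm -ruw; ring: ruw.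
have two0 : 2%:R != 0 :> F.
  by apply: contra_eq_neq w2 => ->; rewrite mul0r eq_sym oner_eq0.
have r0 : r != 0.
  by apply: contra_eq_neq ruw => ->; rewrite mul0r eq_sym sqrf_eq0.
have u0 : u != 0.
  by apply: contra_eq_neq ruw => ->; rewrite mulr0 eq_sym sqrf_eq0.
(* The parameters of [y D y] below come from [r = w^2/u]. *)
have l0 : k * u / w != 0 by rewrite !mulf_neq0 ?invr_neq0.
have Pyy := sgpM Psub (sgpM Psub Pm (PT _ l0)) Pm.
have Er : r = w ^+ 2 / u.
  by apply: (eq_from_scaled_eq (k := u^-1) ruw); field.
have k2m : k ^+ 2 - 1 != 0 by rewrite subr_eq0.
have k2p : k ^+ 2 + 1 != 0.
  apply: contra k4 => /eqP E; apply/eqP.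
  by apply: (eq_from_scaled_eq (k := k ^+ 2 - 1) E); ring.
have k4p : k ^+ 4 + 1 != 0.
  apply: contra k8 => /eqP E; apply/eqP.
  by apply: (eq_from_scaled_eq (k := k ^+ 4 - 1) E); ring.
apply: (core (w ^+ 3 * (k ^+ 2 - 1) / (k * u)) (u * w * (1 - k ^+ 2) / k)
             (w ^+ 2 * (k ^+ 2 + 1) / k)).
- by apply: (eq_sgp Pyy); rewrite ?Er; field; rewrite k0 u0 w0.
- by rewrite !mulf_neq0 ?invr_neq0 ?sqrf_eq0.
- by rewrite !mulf_neq0 ?invr_neq0 ?expf_neq0 ?mulf_neq0.
rewrite -subr_eq0.
have -> : w ^+ 3 * (k ^+ 2 - 1) / (k * u) * (u * w * (1 - k ^+ 2) / k) -
   (w ^+ 2 * (k ^+ 2 + 1) / k) ^+ 2 = - (2%:R * w ^+ 4 * (k ^+ 4 + 1) / k ^+ 2).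
  by field; rewrite k0 u0.
by rewrite oppr_eq0 !mulf_neq0 ?invr_neq0 ?expf_neq0.
Qed.

End SubgroupPredicate.

(** * Generation from a nonsplit torus and a transvection *)

Section FiniteFieldFacts.
Variable F : finFieldType.

(** Nonzero squares have index at most two in the multiplicative group. *)
Lemma sqr_ratio_pigeonhole (a b c : F) : a != 0 -> b != 0 -> c != 0 ->
  exists2 k : F, k != 0 & [\/ b = k ^+ 2 * a, c = k ^+ 2 * a | c = k ^+ 2 * b].
Proof.
move=> a0 b0 c0.
have /cyclicP[g gen] := field_unit_group_cyclic [group of [set: {unit F}]].
have expo x : x != 0 -> exists n, x = FinRing.uval g ^+ n.
  rewrite -unitfE => Ux; have : FinRing.unit F Ux \in <[g]>%g by rewrite -gen inE.
  by case/cyclePmin=> n _ E; exists n; rewrite -FinRing.val_unitX -E.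
set h := FinRing.uval g in expo.
have h0 : h != 0 by rewrite -unitfE (valP g).
have key m n : odd m = odd n -> exists2 k : F, k != 0 & h ^+ n = k ^+ 2 * h ^+ m.
  move=> par; exists (h ^+ n./2 / h ^+ m./2).
    by rewrite mulf_neq0 ?invr_neq0 ?expf_neq0.
  rewrite -{1}(odd_double_half n) -{2}(odd_double_half m) par !exprD -!muln2 !exprM.
  by field; rewrite !expf_neq0.
have [m ->] := expo a a0; have [n ->] := expo b b0; have [l ->] := expo c c0.
have [mn|mn] := eqVneq (odd m) (odd n).
  by have [k k0 E] := key _ _ mn; exists k => //; constructor 1.
have [ml|ml] := eqVneq (odd m) (odd l).
  by have [k k0 E] := key _ _ ml; exists k => //; constructor 2.
have [|k k0 E] := key n l; last by exists k => //; constructor 3.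
by move: mn ml; do 3!case: (odd _).
Qed.

Lemma mem_eq (A : {pred F}) x y : x \in A -> x = y -> y \in A.
Proof. by move=> Ax <-. Qed.

Lemma invr_expf (x : F) : x != 0 -> x^-1 = x ^+ #|F|.-2.
Proof.
move=> x0; apply: (mulfI x0); rewrite divff // -exprS.
have q1 := finNzRing_gt1 F.
have E : #|F| = #|F|.-2.+2 by case: #|F| q1 => [|[]].
by apply: (mulfI x0); rewrite -exprS -E expf_card mulr1.
Qed.

End FiniteFieldFacts.

Section Nonsplit.
Variable F : finFieldType.
Variables (P : F -> F -> F -> F -> bool) (Psub : subgroup_pred P).

(** The ring called R in the introduction. *)
Definition scalers : {pred F} :=
  [pred r | [forall v, (v \in uppers P) ==> (r * v \in uppers P)]].

Lemma scalersP r :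
  reflect (forall v, v \in uppers P -> r * v \in uppers P) (r \in scalers).
Proof.
by apply: (iffP forallP) => h v; [move=> Vv; have /implyP := h v; exact | apply/implyP/h].
Qed.

Lemma scalers1 : 1 \in scalers.
Proof. by apply/scalersP => v; rewrite mul1r. Qed.

Lemma scalersB r r' : r \in scalers -> r' \in scalers -> r - r' \in scalers.
Proof.
move=> /scalersP Rr /scalersP Rr'; apply/scalersP => v Vv.
by rewrite mulrBl uppersD ?uppersN ?Rr ?Rr'.
Qed.

Lemma scalersM r r' : r \in scalers -> r' \in scalers -> r * r' \in scalers.
Proof.
move=> /scalersP Rr /scalersP Rr'; apply/scalersP => v Vv.
by rewrite -mulrA Rr ?Rr'.
Qed.

Lemma scalers0 : 0 \in scalers.
Proof. by rewrite -(subrr 1) scalersB ?scalers1. Qed.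

Lemma scalersN r : r \in scalers -> - r \in scalers.
Proof. by move=> Rr; rewrite -sub0r scalersB ?scalers0. Qed.

Lemma scalersD r r' : r \in scalers -> r' \in scalers -> r + r' \in scalers.
Proof. by move=> Rr Rr'; rewrite -[r']opprK scalersB ?scalersN. Qed.

Lemma scalers_sub1 r : 1 + r \in scalers -> r \in scalers.
Proof. by move=> Rr; rewrite -[r](addKr 1) scalersD ?scalersN ?scalers1. Qed.

Lemma scalersX r n : r \in scalers -> r ^+ n \in scalers.
Proof.
by move=> Rr; elim: n => [|n IH]; rewrite ?expr0 ?scalers1 // exprS scalersM.
Qed.

Lemma scalersV r : r \in scalers -> r^-1 \in scalers.
Proof.
have [->|r0 Rr] := eqVneq r 0; first by rewrite invr0.
by rewrite invr_expf // scalersX.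
Qed.

Lemma scalers_nat n : n%:R \in scalers.
Proof.
by elim: n => [|n IH]; rewrite ?scalers0 // mulrS scalersD ?scalers1.
Qed.

Variable s : F.
(** The determinant of [x + y c], where [c = (0, -1; 1, s)]; as [c] maps the
    first basis vector to the second, [x + y c] has first column [(x, y)]. *)
Definition norm_form (x y : F) := x ^+ 2 + s * x * y + y ^+ 2.

Hypothesis norm_eq0 : forall x y, norm_form x y = 0 -> x = 0 /\ y = 0.
Hypothesis norm1P : forall x y, norm_form x y = 1 -> P x (- y) y (x + s * y).

(** The values of the norm on the orbit of the first basis vector. *)
Definition column_norm n :=
  exists a b c d, P a b c d /\ norm_form a c = n.

Lemma column_norm_eq n n' : column_norm n -> n = n' -> column_norm n'.
Proof. by move=> cn <-. Qed.

Lemma column_norm_neq0 n : column_norm n -> n != 0.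
Proof.
move=> [a [b [c [d [Pm <-]]]]]; apply/eqP => /norm_eq0[a0 c0].
have := sgp_det Psub Pm; rewrite a0 c0 mul0r mulr0 subr0 => /eqP.
by rewrite eq_sym oner_eq0.
Qed.

Lemma column_norm1 : column_norm 1.
Proof.
exists 1, 0, 0, 1; split; first exact: sgp1.
by rewrite /norm_form; ring.
Qed.

(** The norm of the first column of the product of a transvection and an
    element of the torus. *)
Lemma column_norm_shear l x y : l \in uppers P -> norm_form x y = 1 ->
  column_norm (1 + l * y * (2%:R * x + s * y) + l ^+ 2 * y ^+ 2).
Proof.
rewrite inE => Pl N1.
have Pm := sgpM Psub Pl (norm1P N1).
do 4!eexists; split; first exact: Pm.
by rewrite -[X in _ = X + _ + _]N1 /norm_form; ring.
Qed.

(** If [h] and [h'] are the elements of the field F[c] with the two first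
    columns, then [h' / (k h)] has norm 1, so it lies in the subgroup.  Hence the
    orbit of the first basis vector [e] contains [k e]. *)
Lemma column_norm_ratio n n' k : column_norm n -> column_norm n' ->
  k != 0 -> n' = k ^+ 2 * n -> k ^+ 2 \in scalers.
Proof.
move=> cn cn' k0 En; have := column_norm_neq0 cn.
move: cn cn' => [a [b [c [d [Pm Nn]]]]] [a' [b' [c' [d' [Pm' Nn']]]]] n0.
(* [X + Y c] is [h' / (k h)], computed with the conjugate of [h]. *)
pose X := (a' * a + s * a' * c + c' * c) / (k * n).
pose Y := (c' * a - a' * c) / (k * n).
have Nac0 : a ^+ 2 + s * a * c + c ^+ 2 != 0 by rewrite -/(norm_form a c) Nn.
have NXY : norm_form X Y = 1.
  have -> : norm_form X Y = norm_form a c * norm_form a' c' / (k * n) ^+ 2.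
    by rewrite /norm_form /X /Y; field; rewrite k0 n0.
  by rewrite Nn Nn' En; field; rewrite k0 n0.
have detm := sgp_det Psub Pm.
have PA := sgpM Psub (sgpM Psub (sgpV Psub Pm) (sgpV Psub (norm1P NXY))) Pm'.
have Nn2 : n = a ^+ 2 + s * a * c + c ^+ 2 by rewrite -Nn.
have En' : a' ^+ 2 + s * a' * c' + c' ^+ 2 = k ^+ 2 * n by rewrite -En -Nn'.
have e1 : (X + s * Y) * a' + Y * c' = k * a.
  have -> : (X + s * Y) * a' + Y * c' =
    a * (a' ^+ 2 + s * a' * c' + c' ^+ 2) / (k * n).
    by rewrite /X /Y; field; rewrite k0 n0.
  by rewrite En'; field; rewrite k0 n0.
have e2 : - Y * a' + X * c' = k * c.
  have -> : - Y * a' + X * c' = c * (a' ^+ 2 + s * a' * c' + c' ^+ 2) / (k * n).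
    by rewrite /X /Y; field; rewrite k0 n0.
  by rewrite En'; field; rewrite k0 n0.
have c1 : forall z, z = d * ((X + s * Y) * a' + Y * c') - b * (- Y * a' + X * c') ->
    z = k.
  by move=> z ->; rewrite e1 e2; apply: (eq_from_scaled_eq (k := k) detm); ring.
have c2 : forall z, z = - c * ((X + s * Y) * a' + Y * c') + a * (- Y * a' + X * c') ->
    z = 0.
  by move=> z ->; rewrite e1 e2; ring.
have [m Pk] : exists m, P k m 0 k^-1.
  have detA := sgp_det Psub PA; move: PA detA.
  set A11 := (_ + _); set A12 := (_ + _); set A21 := (_ + _); set A22 := (_ + _).
  have -> : A11 = k by apply: c1; rewrite /A11; ring.
  have -> : A21 = 0 by apply: c2; rewrite /A21; ring.
  rewrite mulr0 subr0 => PA detA; exists A12.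
  by apply: (eq_sgp PA) => //; apply: (mulfI k0); rewrite detA divff.
by apply/scalersP => v; exact: uppers_scale Pk.
Qed.

(** In characteristic 2 every norm is a square, so R contains the norms
    [1 + l (l + s)] and [1 + s^2 l (l + s)] obtained from [c] and [c^2]. *)
Lemma sqr_scaler_char2 l : 2 \in [pchar F] -> l \in uppers P ->
  l != 0 -> l + s != 0 -> s ^+ 2 \in scalers.
Proof.
move=> char2 Vl l0 ls0; have two0 : 2%:R = 0 :> F by apply/eqP; case/andP: char2.
have csc n : column_norm n -> n \in scalers.
  move=> cn; have [k Ek] := char2_sqrt two0 n.
  have k0 : k != 0 by rewrite -sqrf_eq0 -Ek column_norm_neq0.
  by rewrite Ek; apply: (column_norm_ratio column_norm1 cn k0); rewrite mulr1.
have N01 : norm_form 0 1 = 1 by rewrite /norm_form; ring.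
have Ns : norm_form (- 1) s = 1 by rewrite /norm_form; ring.
have /csc := column_norm_shear Vl N01; have /csc := column_norm_shear Vl Ns.
rewrite two0 !mul0r !add0r expr1n !mulr1 => R2 R1.
have m0 : l * (l + s) != 0 by rewrite mulf_neq0.
have Rm : l * (l + s) \in scalers.
  by apply: scalers_sub1; apply: (mem_eq R1); ring.
have Rsm : s ^+ 2 * (l * (l + s)) \in scalers.
  by apply: scalers_sub1; apply: (mem_eq R2); ring.
by rewrite -[s ^+ 2](mulfK m0) scalersM ?scalersV.
Qed.

(** Among the norms 1, [1 + 2 s^2] and [1 + 6 s^2], obtained from [c] and the
    transvections of parameters [s] and [2 s], two differ by a square. *)
Lemma sqr_scaler_char_gt3 : 2%:R != 0 :> F -> 3%:R != 0 :> F ->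
  s \in uppers P -> s ^+ 2 \in scalers.
Proof.
move=> two0 three0 Vs; set t := s ^+ 2.
have N01 : norm_form 0 1 = 1 by rewrite /norm_form; ring.
have n1 : column_norm (1 + 2%:R * t).
  by have/column_norm_eq := column_norm_shear Vs N01;apply; rewrite /t; ring.
have n2 : column_norm (1 + 6%:R * t).
  have V2s : 2%:R * s \in uppers P by rewrite mulr_natl uppersMn.
  by have/column_norm_eq := column_norm_shear V2s N01;apply; rewrite /t; ring.
have div m : m%:R != 0 :> F -> m%:R * t \in scalers -> t \in scalers.
  by move=> m0 Rt; rewrite -[t](mulKf m0) scalersM ?scalersV ?scalers_nat.
have six0 : 6%:R != 0 :> F by rewrite (natrM _ 2 3) mulf_neq0.
have [k k0 kE] := sqr_ratio_pigeonhole (oner_neq0 F) (column_norm_neq0 n1)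
                                       (column_norm_neq0 n2).
case: kE => E.
- have := column_norm_ratio column_norm1 n1 k0 E; rewrite mulr1 in E.
  by rewrite -E => R1; apply: (div 2%N) => //; exact: scalers_sub1.
- have := column_norm_ratio column_norm1 n2 k0 E; rewrite mulr1 in E.
  by rewrite -E => R1; apply: (div 6%N) => //; exact: scalers_sub1.
have := column_norm_ratio n1 n2 k0 E; move: E; move: (k ^+ 2) => r E Rr.
have E1 : t * (6%:R - 2%:R * r) = r - 1.
  by apply: (eq_from_scaled_eq (k := 1) E); ring.
have r3 : 6%:R - 2%:R * r != 0.
  apply/eqP => r3; rewrite r3 mulr0 in E1.
  have r1 : r = 1 by apply/eqP; rewrite -subr_eq0 -E1.
  have : 2%:R * 2%:R == 0 :> F by rewrite -r3 r1; apply/eqP; ring.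
  by rewrite mulf_eq0 (negbTE two0).
rewrite -[t](mulfK r3) E1.
by rewrite scalersM ?scalersV ?scalersB ?scalersM ?scalers_nat ?scalers1.
Qed.

(** In characteristic 3 the norms used above are not distinct.  The powers
    [c], [c^2], [c^3] give the norms [1 - t], [1 + t - t^2] and [1 + t - t^3] with
    [t = s^2].  If [t] is not in the field R, then 1 and [1 - t] lie in different
    square classes, so each of the other two norms is an R-multiple of 1 or of
    [1 - t]; as 1 and [t] are independent over R, this leaves only
    [t^2 = - 1], which does occur for q = 9. *)
Lemma sqr_scaler_char3 : 3%:R = 0 :> F -> s \in uppers P ->
  s ^+ 2 \in scalers \/ s ^+ 4 = - 1.
Proof.
move=> three0 Vs; set t := s ^+ 2.
have -> : s ^+ 4 = t ^+ 2 by rewrite -exprM.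
have char3 (a b c : F) := @eq_of_natr0 F 3 c a b three0.
have N01 : norm_form 0 1 = 1 by rewrite /norm_form; ring.
have Ns : norm_form (- 1) s = 1 by rewrite /norm_form; ring.
have Nt : norm_form (- s) (t - 1) = 1 by rewrite /norm_form /t; ring.
have n1 : column_norm (1 - t).
  have/column_norm_eq := column_norm_shear Vs N01;apply.
  by apply: (char3 _ _ t); rewrite /t; ring.
have n2 : column_norm (1 + t - t ^+ 2).
  have/column_norm_eq := column_norm_shear Vs Ns;apply.
  by apply: (char3 _ _ (t ^+ 2 - t)); rewrite /t; ring.
have n3 : column_norm (1 + t - t ^+ 3).
  have/column_norm_eq := column_norm_shear Vs Nt;apply.
  by apply: (char3 _ _ (t ^+ 3 - 2%:R * t ^+ 2 + t)); rewrite /t; ring.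
have [Rt|Rt] := boolP (t \in scalers); [by left | right].
have indep a b : a \in scalers -> b \in scalers -> a * t = b -> a = 0 /\ b = 0.
  move=> Ra Rb E; have [a0|a0] := eqVneq a 0; first by rewrite -E a0 mul0r.
  by case/negP: Rt; rewrite -[t](mulKf a0) E scalersM ?scalersV.
have ratio n m k : column_norm n -> column_norm m -> k != 0 -> m = k ^+ 2 * n ->
    exists2 r, r \in scalers & m = r * n.
  by move=> cn cm k0 E; exists (k ^+ 2) => //; exact: column_norm_ratio cn cm k0 E.
have not1 : ~ (exists2 r, r \in scalers & 1 - t = r * 1).
  by case=> r Rr; rewrite mulr1 => E; case/negP: Rt; rewrite -[t](subKr 1) E scalersB ?scalers1.
have dich m : column_norm m ->
    (exists2 r, r \in scalers & m = r * 1) \/ (exists2 r, r \in scalers & m = r * (1 - t)).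
  move=> cm.
  have [k k0] := sqr_ratio_pigeonhole (oner_neq0 F) (column_norm_neq0 n1)
                                       (column_norm_neq0 cm).
  by case=> E; [exfalso; apply: not1 | left | right];
    apply: (ratio _ _ k) => //; exact: column_norm1.
have noroot c : c \in scalers -> t * (t - c) <> 0.
  move=> Rc /eqP; rewrite mulf_eq0 subr_eq0 => /orP[]/eqP E; case/negP: Rt.
    by rewrite E scalers0.
  by rewrite E.
have [[r Rr E2]|[r Rr E2]] := dich _ n2; have [[r' Rr' E3]|[r' Rr' E3]] := dich _ n3;
  rewrite ?mulr1 in E2 E3.
- have E : (r - 1) * t = r' - r by rewrite -E3 -E2; ring.
  have [||/eqP r1 _] := indep _ _ _ _ E; rewrite ?scalersB ?scalers1 //.
  rewrite subr_eq0 in r1; case: (noroot 1 scalers1).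
  by apply: (eq_from_scaled_eq (k := - 1) E2); rewrite (eqP r1); ring.
- have E : (r - 1 + r') * t = r' - r.
    by apply: (eq_from_scaled_eq (k := 1) E3); rewrite -E2; ring.
  have [||r1 r2] := indep _ _ _ _ E; rewrite ?scalersD ?scalersN ?scalers1 //.
  have r21 : 2%:R * r = 1.
    by apply: (eq_from_scaled_eq (k := 1) r1); move/eqP: r2; rewrite subr_eq0 => /eqP->; ring.
  have r2' : r = 2%:R 
    by apply: (char3 _ _ (r - 1)); apply: (eq_from_scaled_eq (k := - 1) r21); ring.
  have /eqP : (t + 1) ^+ 2 = 0.
    rewrite r2' in E2; apply: (char3 _ _ t).
    by apply: (eq_from_scaled_eq (k := - 1) E2); ring.
  rewrite sqrf_eq0 addr_eq0 => /eqP t1; case/negP: Rt.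
  by rewrite t1 scalersN ?scalers1.
- have E : (1 + r + r ^+ 2) * t = r ^+ 2 - r'.
    by apply: (eq_from_scaled_eq (k := t + 1 + r) E2); rewrite -E3; ring.
  have [||r1 _] := indep _ _ _ _ E; rewrite ?scalersD ?scalersN ?scalersX ?scalers1 //.
  have /eqP : (r - 1) ^+ 2 = 0.
    by apply: (char3 _ _ (- r)); apply: (eq_from_scaled_eq (k := 1) r1); ring.
  rewrite sqrf_eq0 subr_eq0 => /eqP r1'; case: (noroot 2%:R (scalers_nat 2)).
  by apply: (eq_from_scaled_eq (k := - 1) E2); rewrite r1'; ring.
have H : (1 + r + r ^+ 2) * t = r ^+ 2 - (1 + t - t ^+ 3).
  by apply: (eq_from_scaled_eq (k := t + 1 + r) E2); ring.
have E : (1 + r + r ^+ 2 - r') * t = r ^+ 2 - r'.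
  by apply: (eq_from_scaled_eq (k := 1) H); rewrite E3; ring.
have [||r1 r2] := indep _ _ _ _ E; rewrite ?scalersD ?scalersN ?scalersX ?scalers1 //.
have rN1 : r = - 1.
  apply: (eq_from_scaled_eq (k := 1) r1); move/eqP: r2; rewrite subr_eq0 => /eqP <-; ring.
apply: (char3 _ _ 1).
have -> : t ^+ 2 = 1 + t - (1 + t - t ^+ 2) by ring.
by rewrite E2 rN1; ring.
Qed.

End Nonsplit.

(** * Powers of matrices of determinant one and roots of unity *)

Section Powers.

(** If [g] has determinant 1 and trace [t], then [g^n = x g + y] with
    [(x, y) = cheb t n]; the first components are Chebyshev polynomials of the
    second kind. *)
Fixpoint cheb (R : comPzRingType) (t : R) n : R * R :=
  if n is m.+1 then ((cheb t m).1 * t + (cheb t m).2, - (cheb t m).1)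
  else (0, 1).

Lemma rmorph_cheb (R S : comPzRingType) (f : {rmorphism R -> S}) t n :
  cheb (f t) n = (f (cheb t n).1, f (cheb t n).2).
Proof.
by elim: n => [|n /= ->]; rewrite /= ?rmorph0 ?rmorph1 // rmorphD rmorphM rmorphN.
Qed.

Lemma cheb_root (L : fieldType) (e : L) n : e != 0 ->
  (cheb (e + e^-1) n).1 * e + (cheb (e + e^-1) n).2 = e ^+ n.
Proof.
move=> e0; elim: n => [|n IH]; first by rewrite /= expr0 mul0r add0r.
by rewrite exprS -IH /=; field.
Qed.

(** [x (e - 1/e) = e^n - e^-n], from the previous lemma for [e] and [1/e]. *)
Lemma cheb_eq0 (L : fieldType) (e : L) n : e != 0 -> e ^+ 2 != 1 ->
  ((cheb (e + e^-1) n).1 == 0) = (e ^+ (2 * n) == 1).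
Proof.
move=> e0 e1.
have E1 := cheb_root n e0.
have E2 := cheb_root n (invr_neq0 e0); rewrite invrK [_^-1 + _]addrC in E2.
have E : (cheb (e + e^-1) n).1 * (e ^+ 2 - 1) = e * (e ^+ n - e^-1 ^+ n).
  by rewrite -E1 -E2; field.
have e1' : e ^+ 2 - 1 != 0 by rewrite subr_eq0.
rewrite -(mulIr_eq0 _ (mulIf e1')) E mulf_eq0 (negbTE e0) /= mul2n -addnn exprD.
by rewrite subr_eq0 -(inj_eq (mulIf (expf_neq0 n e0))) exprVn mulVf ?expf_neq0.
Qed.

End Powers.

Section TorusFacts.
Variable F : finFieldType.

Lemma expf_card_pred (x : F) : x != 0 -> x ^+ #|F|.-1 = 1.
Proof.
move=> x0; apply: (mulfI x0).
by rewrite -exprS prednK ?expf_card ?mulr1 // ltnW ?finNzRing_gt1.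
Qed.

Lemma exists_generator : exists a : F, #|F|.-1.-primitive_root a.
Proof.
have q0 : (0 < #|F|.-1)%N by have := finNzRing_gt1 F; case: #|F| => [|[]].
have /hasP[a _ pa] : has (#|F|.-1).-primitive_root [seq x <- enum F | x != 0].
  apply: has_prim_root => //.
  - apply/allP=> x; rewrite mem_filter => /andP[x0 _].
    by rewrite unity_rootE expf_card_pred.
  - by rewrite filter_uniq ?enum_uniq.
  by rewrite -(cardC1 (0 : F)) cardE enumT /enum_mem; apply/eq_leq; congr size; apply: eq_filter.
by exists a.
Qed.

Lemma card_natr0 : #|F|%:R = 0 :> F.
Proof.
have := expg_cardG (in_setT (1%R : F)).
by rewrite cardsT FinRing.zmodXgE.
Qed.

Lemma pnat_card p : p \in [pchar F] -> p.-nat #|F|.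
Proof.
by move=> pF; have := abelem_pgroup (fin_ring_pchar_abelem pF); rewrite /pgroup cardsT.
Qed.

Variables (K : fieldType) (f : {rmorphism F -> K}).

(** A divisor of the order of F is a power of the characteristic. *)
Lemma Frobenius_sub_card n (x y : K) : (n %| #|F|)%N ->
  (x + y) ^+ n = x ^+ n + y ^+ n.
Proof.
move=> nF; apply: exprDn_pchar; have [p p_pr pF] := finPcharP F.
apply: pnat_dvd nF _; apply: sub_in_pnat (pnat_card pF) => l _ /eqP ->.
by rewrite (fmorph_pchar f).
Qed.

Lemma expf_card_image x : f x ^+ #|F| = f x.
Proof. by rewrite -rmorphXn expf_card. Qed.

(** The polynomial [X^q - X] splits over F. *)
Lemma image_of_expf_card (x : K) : x ^+ #|F| = x -> exists y, x = f y.
Proof.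
move=> xq; have := finField_genPoly F; move/(congr1 (map_poly f)).
rewrite rmorphB /= map_polyXn map_polyX rmorph_prod => /(congr1 (horner^~ x)).
rewrite !hornerE xq subrr horner_prod => /esym/eqP; rewrite prodf_seq_eq0.
case/hasP=> y _ /=; rewrite rmorphB /= map_polyX map_polyC !hornerE subr_eq0.
by move/eqP=> ->; exists y.
Qed.

Variables (u : K) (s : F).
Hypotheses (u_prim : #|F|.+1.-primitive_root u) (s_tr : f s = u + u^-1).

Lemma prim_neq0 : u != 0.
Proof.
apply/eqP => u0; have := prim_expr_order u_prim.
by rewrite u0 exprS mul0r => /eqP; rewrite eq_sym oner_eq0.
Qed.

Lemma expf_card_prim : u ^+ #|F| = u^-1.
Proof.
apply: (mulfI prim_neq0); rewrite -exprS divff ?prim_neq0 //.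
exact: prim_expr_order u_prim.
Qed.

Lemma prim_notin_image x : u != f x.
Proof.
apply/eqP => E; have := expf_card_prim; rewrite {1}E expf_card_image -E => Eu.
have : u ^+ 2 == 1 by rewrite expr2 {2}Eu divff ?prim_neq0.
rewrite -(prim_order_dvd u_prim) => dv.
by have := @dvdn_leq _ 2 isT dv; rewrite ltnNge finNzRing_gt1.
Qed.

Lemma image_coords_inj x y x' y' :
  f x + f y * u = f x' + f y' * u -> x = x' /\ y = y'.
Proof.
move=> E.
have [yy|yy] := eqVneq y y'.
  by move: E; rewrite yy => /addIr/(fmorph_inj f).
have yy0 : f y - f y' != 0 by rewrite -rmorphB fmorph_eq0 subr_eq0.
case/negP: (prim_notin_image ((x' - x) / (y - y'))).
apply/eqP/(mulfI yy0); rewrite fmorph_div !rmorphB /= mulrCA divff // mulr1.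
by apply: (eq_from_scaled_eq (k := 1) E); ring.
Qed.

(** The Frobenius map of F(u) inverts [u], so the right-hand side is the norm
    of [x + y u] from F(u) to F. *)
Lemma norm_formE x y :
  f (norm_form s x y) = (f x + f y * u) * (f x + f y * u) ^+ #|F|.
Proof.
rewrite Frobenius_sub_card ?dvdnn // exprMn !expf_card_image expf_card_prim.
rewrite /norm_form !(rmorphD, rmorphM, rmorphXn) /= s_tr.
by field; exact: prim_neq0.
Qed.

Lemma norm_form_eq0 x y : norm_form s x y = 0 -> x = 0 /\ y = 0.
Proof.
move=> /(congr1 f)/eqP; rewrite norm_formE rmorph0 mulf_eq0 expf_eq0.
rewrite (ltnW (finNzRing_gt1 F)) /= orbb => /eqP E.
by apply: image_coords_inj; rewrite E !rmorph0 mul0r addr0.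
Qed.

(** An element of F(u) of norm 1 is a (q + 1)-th root of unity. *)
Lemma norm_form_eq1 x y : norm_form s x y = 1 ->
  exists n, y = (cheb s n).1 /\ x = (cheb s n).2.
Proof.
move=> /(congr1 f); rewrite norm_formE rmorph1 -exprS => /(prim_rootP u_prim)[n E].
have := cheb_root n prim_neq0; rewrite -s_tr rmorph_cheb /= -E addrC mulrC => E'.
exists n; suff [-> ->] : x = (cheb s n).2 /\ y = (cheb s n).1 by [].
by apply: image_coords_inj; rewrite -E' mulrC.
Qed.

End TorusFacts.

(** In an algebraic closure, [u + 1/u] is fixed by the Frobenius map, which
    inverts [u]. *)
Lemma exists_nonsplit_trace (F : finFieldType) :
  exists (K : fieldType) (f : {rmorphism F -> K}) (u : K) (s : F),
  #|F|.+1.-primitive_root u /\ f s = u + u^-1.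
Proof.
have [K [f _]] := countable_algebraic_closure F.
have q0 : (#|F|%:R = 0 :> K)%R.
  by have /(congr1 f) := card_natr0 F; rewrite rmorph_nat rmorph0.
have [r Dr] := closed_field_poly_normal ('X^(#|F|.+1) - 1 : {poly K}).
rewrite (monicP _) ?monicXnsubC // scale1r in Dr.
have rn1: all (#|F|.+1).-unity_root r.
  by apply/allP=> z; rewrite -root_prod_XsubC -Dr.
have sz_r: (#|F|.+1 <= size r)%N.
  by rewrite -ltnS -(size_prod_XsubC r id) -Dr size_XnsubC.
have /hasP[u _ pu] : has (#|F|.+1).-primitive_root r.
  apply: has_prim_root => //.
  rewrite -separable_prod_XsubC -Dr separable_Xn_sub_1 //.
  by rewrite -addn1 natrD q0 add0r oner_eq0.
have [s Es] : exists s, u + u^-1 = f s.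
  apply: (@image_of_expf_card F K f); rewrite (Frobenius_sub_card f) //.
  by rewrite exprVn (expf_card_prim pu) invrK addrC.
by exists K, f, u, s.
Qed.

(** * The field generated by the square of a torus trace *)

Lemma card_addsubgroup_dvd (F : finZmodType) (R : {pred F}) : 0 \in R ->
  {in R &, forall x y, x + y \in R} -> (#|R| %| #|F|)%N.
Proof.
move=> R0 RD.
have gR : group_set [set x in R].
  by apply/group_setP; split=> [|x y]; rewrite !inE //; exact: RD.
by have := cardSg (subsetT (Group gR)); rewrite /= cardsT cardsE.
Qed.

(** If [u^2 + u^-2] is fixed by [x |-> x^r], then [u^(2r)] is [u^2] or
    [u^-2], so the order q + 1 of [u] divides [2 (r - 1)] or [2 (r + 1)]. *)
Lemma frobenius_fixed_trace_bound (F : finFieldType) (K : fieldType)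
    (f : {rmorphism F -> K}) (u : K) (s : F) (r : nat) :
  #|F|.+1.-primitive_root u -> f s = u + u^-1 -> (r %| #|F|)%N -> (1 < r)%N ->
  (s ^+ 2 - 2%:R) ^+ r = s ^+ 2 - 2%:R -> (#|F|.+1 <= 2 * r.+1)%N.
Proof.
move=> u_prim s_tr rq r1; have u0 := prim_neq0 u_prim.
have ft : f (s ^+ 2 - 2%:R) = u ^+ 2 + u ^- 2.
  by rewrite rmorphB rmorphXn rmorph_nat /= s_tr; field.
move/(congr1 f); rewrite rmorphXn /= ft (Frobenius_sub_card f) //.
set A := (u ^+ 2) ^+ _; rewrite exprVn -/A => E.
have A0 : A != 0 by rewrite !expf_neq0.
have /eqP : (A - u ^+ 2) * (A * u ^+ 2 - 1) = 0.
  apply: (eq_from_scaled_eq (k := A * u ^+ 2) E); field.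
  by rewrite u0.
rewrite mulf_eq0 !subr_eq0 => /orP[] /eqP EA.
  have : u ^+ (2 * r.-1) == 1.
    rewrite exprM -(inj_eq (mulIf (expf_neq0 2 u0))) mul1r -exprSr.
    by rewrite (prednK (ltnW r1)) -/A EA.
  rewrite -(prim_order_dvd u_prim) => dv.
  have /dvdn_leq/(_ dv) : (0 < 2 * r.-1)%N by lia.
  by move/leq_trans; apply; lia.
have : u ^+ (2 * r.+1) == 1 by rewrite exprM exprSr -/A EA.
rewrite -(prim_order_dvd u_prim) => dv.
by have /dvdn_leq/(_ dv) : (0 < 2 * r.+1)%N by lia.
Qed.

Section Subring.
Variables (F : finFieldType) (R : {pred F}).
Hypotheses (R1 : 1 \in R) (RB : {in R &, forall x y, x - y \in R})
  (RM : {in R &, forall x y, x * y \in R}).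

Lemma subring0 : 0 \in R. Proof. by rewrite -(subrr 1) RB. Qed.

Lemma subringD : {in R &, forall x y, x + y \in R}.
Proof.
by move=> x y Rx Ry; rewrite -[y]opprK RB // -sub0r RB ?subring0.
Qed.

Lemma card_subring_units :
  (#|R|.-1 %| #|F|.-1)%N /\ {in R, forall x, x ^+ #|R| = x}.
Proof.
have gU : group_set [set x : {unit F} | FinRing.uval x \in R].
  apply/group_setP; split=> [|x y]; rewrite !inE //; exact: RM.
have cU : #|Group gU| = #|R|.-1.
  rewrite -(card_imset _ val_inj) (cardD1 0 R) subring0 /=.
  apply: eq_card => x; rewrite !inE; apply/imsetP/andP => [[y]|[x0 Rx]].
    rewrite inE => Ry ->; split=> //.
    by rewrite -unitfE (valP y).
  by exists (FinRing.unit F (etrans (unitfE x) x0)); rewrite ?inE.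
split; first by rewrite -cU -card_finField_unit cardSg ?subsetT.
have R0 : (0 < #|R|)%N by apply/card_gt0P; exists 1.
move=> x Rx; have [->|x0] := eqVneq x 0; first by rewrite expr0n eqn0Ngt R0.
pose y := FinRing.unit F (etrans (unitfE x) x0).
have Uy : y \in Group gU by rewrite inE.
have := expg_cardG Uy; rewrite cU => /(congr1 val).
rewrite FinRing.val_unitX /= => E.
by rewrite -(prednK R0) exprS E mulr1.
Qed.

(** If R has r elements, then [x^r = x] on R, and the previous bound applied to
    [s^2 - 2 = u^2 + u^-2] gives [q <= 2 r + 1].  As r divides q, the only other
    possibility is q = 2 r; then r - 1 divides q - 1 = 2 (r - 1) + 1, so
    q = 4. *)
Lemma subring_full (K : fieldType) (f : {rmorphism F -> K}) (u : K) (s : F) :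
  #|F|.+1.-primitive_root u -> f s = u + u^-1 -> (4 < #|F|)%N ->
  s ^+ 2 \in R -> forall x, x \in R.
Proof.
move=> u_prim s_tr q4 Rs.
have u0 := prim_neq0 u_prim.
have rq : (#|R| %| #|F|)%N.
  by apply: card_addsubgroup_dvd; [exact: subring0 | exact: subringD].
have [r1q Rr] := card_subring_units.
have r1 : (1 < #|R|)%N.
  rewrite (cardD1 0) subring0 (cardD1 1) !inE oner_eq0 R1; lia.
have bound : (#|F|.+1 <= 2 * #|R|.+1)%N.
  apply: (frobenius_fixed_trace_bound u_prim s_tr rq r1).
  by apply: Rr; rewrite RB // (natrD _ 1 1) subringD.
have RF : #|R| = #|F|.
  have [t Et] := dvdnP rq; rewrite Et in r1q q4 bound *.
  have t2 : (t <= 2)%N by nia.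
  have : t != 0%N by apply: contraL q4 => /eqP ->.
  case: t t2 {Et} r1q q4 bound => [|[|[|t]]] // _; rewrite ?mul1n // => dv.
  have : (#|R|.-1 %| 1)%N.
    have -> : (1 = (2 * #|R|).-1 - 2 * #|R|.-1)%N by lia.
    by rewrite dvdn_sub // dvdn_mull.
  rewrite dvdn1; lia.
move=> x; have /subset_cardP H := RF.
by rewrite (H _) ?inE //; apply/subsetP.
Qed.

End Subring.

Section FullNonsplit.
Variable F : finFieldType.
Variables (P : F -> F -> F -> F -> bool) (Psub : subgroup_pred P).
Variables (K : fieldType) (f : {rmorphism F -> K}) (u : K) (s : F).
Hypotheses (u_prim : #|F|.+1.-primitive_root u) (s_tr : f s = u + u^-1).
Hypothesis q5 : (5 < #|F|)%N.

Lemma sgp_companion_powers n : P 0 (- 1) 1 s ->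
  P (cheb s n).2 (- (cheb s n).1) (cheb s n).1 ((cheb s n).2 + s * (cheb s n).1).
Proof.
move=> Pc; elim: n => [|n IH] /=.
  by apply: (eq_sgp (sgp1 Psub)); ring.
by apply: (eq_sgp (sgpM Psub IH Pc)); ring.
Qed.

Lemma prim_trace_neq0 : s != 0.
Proof.
apply/eqP => s0; have u0 := prim_neq0 u_prim.
have u2 : u ^+ 2 = - 1.
  by move: s_tr; rewrite s0 rmorph0 => E; apply: (eq_from_scaled_eq (k := - u) E); field.
have : u ^+ 4 == 1 by rewrite (exprM u 2 2) u2 sqrrN expr1n.
rewrite -(prim_order_dvd u_prim) => /(@dvdn_leq _ 4 isT); lia.
Qed.

(** The two choices of [l] make the trace [l + s] of [c z] equal to [- s] in odd
    characteristic, and to [s^2], the trace of [c^2], in characteristic 2. *)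
Lemma full_nonsplit l : P 0 (- 1) 1 s -> P 1 l 0 1 -> #|F| <> 9%N ->
  (l = - (2%:R * s) /\ 2%:R != 0 :> F) \/ (2 \in [pchar F] /\ l = s ^+ 2 + s /\ s != 1) ->
  full_pred P.
Proof.
move=> Pc Pl q9 cases.
have s0 := prim_trace_neq0.
have N0 := norm_form_eq0 u_prim s_tr.
have N1 x y : norm_form s x y = 1 -> P x (- y) y (x + s * y).
  by case/(norm_form_eq1 u_prim s_tr) => n [-> ->]; exact: sgp_companion_powers.
have Vl : l \in uppers P by rewrite inE.
have [l0 Rs] : l != 0 /\ s ^+ 2 \in scalers P.
  case: cases => [[El two0] | [char2 [El s1]]]; last first.
    have l0 : l != 0.
      have -> : l = s * (s - 1).
        have two0 : 2%:R = 0 :> F by apply/eqP; case/andP: char2.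
        by apply: (eq_from_scaled_eq (k := s) two0); rewrite El; ring.
      by rewrite mulf_neq0 // subr_eq0.
    split=> //; apply: (sqr_scaler_char2 Psub N0 N1 char2 Vl l0).
    have -> : l + s = s ^+ 2.
      have two0 : 2%:R = 0 :> F by apply/eqP; case/andP: char2.
      by apply: (eq_from_scaled_eq (k := s) two0); rewrite El; ring.
    by rewrite expf_neq0.
  have l0 : l != 0 by rewrite El oppr_eq0 mulf_neq0.
  split=> //; have Vs : s \in uppers P.
    have [p p_pr pF] := finPcharP F.
    have podd : odd p.
      by case: (even_prime p_pr) => // p2; move: pF; rewrite p2 inE (negbTE two0).
    (* p = 2 (p./2) + 1 vanishes in F, so - 2 (p./2) = 1. *)
    have -> : s = l *+ p./2.
      have := pcharf0 pF; rewrite -{1}(odd_double_half p) podd -mul2n natrD natrM /= -[true%:R]/(1 : F).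
      rewrite El -mulr_natl => E.
      by apply: (eq_from_scaled_eq (k := s) E); ring.
    exact: uppersMn.
  have [three0|three0] := eqVneq (3%:R : F) 0; last exact: sqr_scaler_char_gt3.
  have [//|s4] := sqr_scaler_char3 Psub N0 N1 three0 Vs.
  (* If s^4 = - 1 then s^2 is fixed by x |-> x^9. *)
  have char3 : 3 \in [pchar F] by rewrite inE /= three0.
  have /p_natP[k qk] := pnat_card char3.
  have k2 : (1 < k)%N by move: q5; rewrite qk; case: k {qk} => [|[]].
  have /(frobenius_fixed_trace_bound u_prim s_tr) : (3 ^ 2 %| #|F|)%N.
    by rewrite qk dvdn_exp2l.
  have -> : (s ^+ 2 - 2%:R) ^+ (3 ^ 2) = s ^+ 2 - 2%:R.
    have s16 : s ^+ 16 = 1 by rewrite (exprM s 4 4) s4; ring.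
    rewrite [in LHS](_ : 2%:R = - 1); last by apply: (eq_from_scaled_eq (k := 1) three0); ring.
    rewrite opprK (Frobenius_sub_card idfun) ?qk ?dvdn_exp2l // expr1n -exprM.
    rewrite (exprD s 16 2) s16 mul1r.
    by apply: (eq_from_scaled_eq (k := 1) three0); ring.
  (* The bound for r = 9 leaves only q = 9 among the powers of 3. *)
  move/(_ isT erefl); case: k qk k2 => [|[|[|k]]] // qk _.
  by rewrite qk !expnS => b; have := expn_gt0 3 k; lia.
have RT := subring_full (scalers1 _) (scalersB Psub) (@scalersM _ _) u_prim s_tr _ Rs.
apply: (full_of_uppers Psub _ Pc (oner_neq0 _)) => v.
have /scalersP/(_ l Vl) := RT (ltnW q5) (v / l).
by rewrite divfK.
Qed.

End FullNonsplit.

(** * Two by two matrices and their images in L2 *)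

Section Matrices.
Variable F : finFieldType.
Implicit Types a b c d : F.

Definition mat2 a b c d : 'M[F]_2 :=
  \matrix_(i, j) if i == 0 then if j == 0 then a else b
                 else if j == 0 then c else d.

Lemma mat2_eta (A : 'M[F]_2) : A = mat2 (A 0 0) (A 0 1) (A 1 0) (A 1 1).
Proof.
apply/matrixP=> i j; rewrite mxE.
by case: i j => [[|[|//]] hi] [[|[|//]] hj]; congr (A _ _); apply: val_inj.
Qed.

Lemma mat2_inj a b c d a' b' c' d' : mat2 a b c d = mat2 a' b' c' d' ->
  [/\ a = a', b = b', c = c' & d = d'].
Proof.
move=> E; have e i j := congr1 (fun A : 'M[F]_2 => A i j) E.
by move: (e 0 0) (e 0 1) (e 1 0) (e 1 1); rewrite !mxE.
Qed.

Lemma det_mat2 a b c d : \det (mat2 a b c d) = a * d - b * c.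
Proof.
rewrite (expand_det_row _ 0) !big_ord_recl big_ord0 /cofactor !det_mx11 !mxE /=.
by rewrite /bump /=; ring.
Qed.

Lemma mul_mat2 a b c d a' b' c' d' : mat2 a b c d *m mat2 a' b' c' d' =
  mat2 (a * a' + b * c') (a * b' + b * d') (c * a' + d * c') (c * b' + d * d').
Proof.
apply/matrixP=> i j; rewrite !mxE !big_ord_recl big_ord0 !mxE addr0.
by case: i j => [[|[|//]] hi] [[|[|//]] hj].
Qed.

Lemma mat2_scalar a : mat2 a 0 0 a = a%:M.
Proof.
apply/matrixP=> i j; rewrite !mxE.
by case: i j => [[|[|//]] hi] [[|[|//]] hj].
Qed.

Definition gl2 a b c d : {'GL_2[F]} := insubd (1%g : {'GL_2[F]}) (mat2 a b c d).

Lemma val_gl2 a b c d : a * d - b * c != 0 -> GLval (gl2 a b c d) = mat2 a b c d.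
Proof.
move=> D0; rewrite [LHS](_ : _ = val (gl2 a b c d)); last by case: (gl2 _ _ _ _).
by rewrite insubdK // [_ \in _]unitmxE det_mat2 unitfE.
Qed.

Lemma gl2_eta (g : {'GL_2[F]}) : exists a b c d, a * d - b * c != 0 /\ g = gl2 a b c d.
Proof.
have E := mat2_eta (GLval g); move: E.
set a := GLval g 0 0; set b := GLval g 0 1; set c := GLval g 1 0; set d := GLval g 1 1.
move=> E; have D0 : a * d - b * c != 0 by have := GL_det g; rewrite E det_mat2.
exists a, b, c, d; split=> //; apply: val_inj.
by move: (val_gl2 D0) E; case: (g) (gl2 a b c d) => [A uA] [B uB] /= -> ->.
Qed.

Lemma gl2M a b c d a' b' c' d' :
  a * d - b * c != 0 -> a' * d' - b' * c' != 0 ->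
  (gl2 a b c d * gl2 a' b' c' d')%g =
  gl2 (a * a' + b * c') (a * b' + b * d') (c * a' + d * c') (c * b' + d * d').
Proof.
move=> D0 D0'; apply: val_inj.
have D0'' : (a * a' + b * c') * (c * b' + d * d') -
            (a * b' + b * d') * (c * a' + d * c') != 0.
  by rewrite [X in X != 0](_ : _ = (a * d - b * c) * (a' * d' - b' * c'));
    [rewrite mulf_neq0 | ring].
have EV (g : {'GL_2[F]}) : val g = GLval g by case: g.
by rewrite !EV GL_ME !val_gl2 // -mul_mat2.
Qed.

Lemma gl2_1 : gl2 1 0 0 1 = 1%g.
Proof.
apply: val_inj; have EV (g : {'GL_2[F]}) : val g = GLval g by case: g.
by rewrite !EV val_gl2 ?GL_1E ?mat2_scalar // mulr1 mulr0 subr0 oner_neq0.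
Qed.

Lemma det1_neq0 (x : F) : x = 1 -> x != 0.
Proof. by move=> ->; exact: oner_neq0. Qed.

Lemma det_GLM (g h : {'GL_2[F]}) :
  \det (GLval (g * h)%g) = \det (GLval g) * \det (GLval h).
Proof. by rewrite GL_ME det_mulmx. Qed.

Lemma gl2V a b c d : a * d - b * c = 1 -> (gl2 a b c d)^-1%g = gl2 d (- b) (- c) a.
Proof.
move=> D1; apply/eqP; rewrite eq_invg_mul.
have D1' : d * a - - b * - c = 1 by rewrite -D1; ring.
rewrite gl2M ?det1_neq0 // -gl2_1; apply/eqP; congr (gl2 _ _ _ _).
- by rewrite -D1; ring.
- by ring.
- by ring.
- by rewrite -D1; ring.
Qed.

Lemma gl2_SL2 a b c d : a * d - b * c = 1 -> gl2 a b c d \in SL2 F.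
Proof. by move=> D1; rewrite inE val_gl2 ?det1_neq0 // det_mat2 D1. Qed.

Lemma SL2P (g : {'GL_2[F]}) : g \in SL2 F ->
  exists a b c d, a * d - b * c = 1 /\ g = gl2 a b c d.
Proof.
have [a [b [c [d [D0 ->]]]]] := gl2_eta g.
by rewrite inE val_gl2 // det_mat2 => /eqP D1; exists a, b, c, d.
Qed.

Lemma gl2_pmI a b c d : a * d - b * c = 1 ->
  (gl2 a b c d \in pmI F) = [&& b == 0, c == 0 & a == d].
Proof.
move=> D1; rewrite inE val_gl2 ?det1_neq0 // -scaleN1r -!mat2_scalar.
have -> : -1 *: mat2 1 0 0 1 = mat2 (- 1) 0 0 (- 1).
  by rewrite !mat2_scalar scale_scalar_mx mulr1.
apply/orP/and3P => [[/eqP/mat2_inj[-> -> -> ->] // | /eqP/mat2_inj[-> -> -> ->] //] |].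
case=> /eqP b0 /eqP c0 /eqP ad; move: D1; rewrite b0 c0 ad mul0r subr0 => /eqP.
rewrite -expr2 sqrf_eq1 => /orP[]/eqP ->; [left | right]; exact/eqP.
Qed.

Lemma cheb_norm (t : F) n :
  (cheb t n).2 ^+ 2 + t * (cheb t n).2 * (cheb t n).1 + (cheb t n).1 ^+ 2 = 1.
Proof. by elim: n => [|n IH] /=; [ring | rewrite -[RHS]IH; ring]. Qed.

Lemma gl2X a b c d n : a * d - b * c = 1 ->
  let al := (cheb (a + d) n).1 in let be := (cheb (a + d) n).2 in
  (al * a + be) * (al * d + be) - al * b * (al * c) = 1 /\
  (gl2 a b c d ^+ n)%g = gl2 (al * a + be) (al * b) (al * c) (al * d + be).
Proof.
move=> D1.
have Dn m : ((cheb (a + d) m).1 * a + (cheb (a + d) m).2) *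
    ((cheb (a + d) m).1 * d + (cheb (a + d) m).2) -
    (cheb (a + d) m).1 * b * ((cheb (a + d) m).1 * c) = 1.
  rewrite -[RHS](cheb_norm (a + d) m).
  by apply: (eq_from_scaled_eq (k := (cheb (a + d) m).1 ^+ 2) D1); ring.
split; first exact: Dn.
elim: n => [|n IH] /=; first by rewrite expg0 -gl2_1; congr gl2; ring.
rewrite expgS IH gl2M ?det1_neq0 //; move: (cheb _ n).1 (cheb _ n).2 => al be.
congr gl2; [| ring | ring |]; apply: (eq_from_scaled_eq (k := - al) D1); ring.
Qed.

Definition nonscalar a b c d := [|| b != 0, c != 0 | a != d].

Notation bar g := (coset (pmI F) g).

Lemma norm_pmI (g : {'GL_2[F]}) : g \in 'N(pmI F)%g.
Proof.
apply: (subsetP (cents_norm _) g (in_setT g)); apply/centsP=> v _ w; rewrite inE => wI.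
apply: val_inj; rewrite [LHS]GL_ME [RHS]GL_ME.
by case/orP: wI => /eqP->; rewrite ?mulNr ?mulrN ?mul1r ?mulr1.
Qed.

(** The order of the image of a nonscalar matrix of SL2 depends only on its
    trace. *)
Lemma bar_expn_eq1 a b c d n : a * d - b * c = 1 -> nonscalar a b c d ->
  (bar (gl2 a b c d) ^+ n == 1)%g = ((cheb (a + d) n).1 == 0).
Proof.
move=> D1 nsc; have Ng := norm_pmI (gl2 a b c d).
have [Dn En] := gl2X n D1.
rewrite -morphX //=; have -> : (bar (gl2 a b c d ^+ n) == 1)%g =
    (gl2 a b c d ^+ n \in pmI F)%g.
  by apply/eqP/idP; [apply: coset_idr; rewrite groupX | exact: coset_id].
rewrite En gl2_pmI //; set al := (cheb _ _).1; set be := (cheb _ _).2.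
apply/and3P/eqP=> [[]|->]; last by rewrite !mul0r.
rewrite !mulf_eq0 (inj_eq (addIr be)) -subr_eq0 -mulrBr mulf_eq0 subr_eq0.
by case/or3P: nsc => /negbTE->; rewrite ?orbF => *; apply/eqP.
Qed.

Lemma bar_expn1 a b c d n : a * d - b * c = 1 -> (cheb (a + d) n).1 = 0 ->
  (bar (gl2 a b c d) ^+ n = 1)%g.
Proof.
move=> D1 al0; have Ng := norm_pmI (gl2 a b c d).
have [Dn En] := gl2X n D1.
rewrite -morphX //=; apply: coset_id; rewrite En gl2_pmI //.
by rewrite al0 !mul0r !eqxx.
Qed.

End Matrices.

(** * From pairs of matrices to strongly real Beauville structures *)

Local Close Scope ring_scope.
Local Open Scope group_scope.

Lemma order_ge (gT : finGroupType) (x : gT) n :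
  (forall k, 0 < k < n -> x ^+ k != 1) -> n <= #[x].
Proof.
move=> H; rewrite leqNgt; apply/negP => lt.
by have := H #[x]; rewrite order_gt0 lt expg_order eqxx => /(_ isT).
Qed.

Section HyperbolicTypes.
Import Order.TTheory Num.Theory.

Lemma inv_nat_le (m n : nat) : (0 < m <= n)%N -> ((n%:R)^-1 <= (m%:R)^-1 :> rat)%R.
Proof.
by case/andP=> m0 mn; rewrite lef_pV2 ?posrE ?ltr0n ?ler_nat // (leq_trans m0).
Qed.

Lemma hyperbolic_552 l m n : 5 <= l -> 5 <= m -> 2 <= n ->
  (l%:R^-1 + m%:R^-1 + n%:R^-1 < 1 :> rat)%R.
Proof.
move=> l5 m5 n2; have := @inv_nat_le 5 l l5; have := @inv_nat_le 5 m m5.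
have := @inv_nat_le 2 n n2; lra.
Qed.

Lemma hyperbolic_444 l m n : 4 <= l -> 4 <= m -> 4 <= n ->
  (l%:R^-1 + m%:R^-1 + n%:R^-1 < 1 :> rat)%R.
Proof.
move=> l5 m5 n2; have := @inv_nat_le 4 l l5; have := @inv_nat_le 4 m m5.
have := @inv_nat_le 4 n n2; lra.
Qed.

(** Three inverses of positive integers at most 3 have sum at least 1. *)
Lemma hyperbolic_order_gt3 l m n : 0 < l -> 0 < m -> 0 < n ->
  (l%:R^-1 + m%:R^-1 + n%:R^-1 < 1 :> rat)%R -> [|| 3 < l, 3 < m | 3 < n].
Proof.
move=> l0 m0 n0; rewrite !ltnNge -!negb_and; apply: contraTN => /and3P[l3 m3 n3].
rewrite -leNgt; have := @inv_nat_le l 3; rewrite l0 l3 => /(_ isT).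
have := @inv_nat_le m 3; rewrite m0 m3 => /(_ isT).
have := @inv_nat_le n 3; rewrite n0 n3 => /(_ isT); lra.
Qed.

End HyperbolicTypes.

Lemma nonconjugate_powers_coprime (gT : finGroupType) (G : {group gT})
    (A B : {set gT}) N M : coprime N M ->
  {in A, forall a, a ^+ N = 1} -> {in B, forall b, b ^+ M = 1} ->
  nonconjugate_powers G A B.
Proof.
move=> co AN BM a b i j aA bB; apply: contra => /imsetP[g _ E].
have bN : (b ^+ j) ^+ N = 1.
  by rewrite E -conjXg -expgM mulnC expgM AN // expg1n conj1g.
have bM : (b ^+ j) ^+ M = 1 by rewrite -expgM mulnC expgM BM // expg1n.
have b1 : b ^+ j = 1.
  apply/eqP; rewrite -order_eq1 -dvdn1 -(eqP co) dvdn_gcd !order_dvdn.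
  by rewrite bN bM eqxx.
by rewrite -(conjg_eq1 _ g) -E b1.
Qed.

Section Assembly.
Variable F : finFieldType.
Local Notation bar g := (coset (pmI F) g).

Lemma norm_SL2 (g : {'GL_2[F]}) : g \in 'N(SL2 F).
Proof.
rewrite inE; apply/subsetP=> _ /imsetP[h Sh ->]; move: Sh; rewrite !inE.
rewrite /conjg !det_GLM => /eqP->; rewrite mul1r -det_GLM.
by rewrite mulVg GL_1E det1.
Qed.

(** The data of one half of a strongly real Beauville structure, upstairs in
    SL2: the triple is formed by the images of [X], [Y] and of the inverse of
    [X * Y], [N] is an exponent common to the three images, and [J] induces the
    automorphism that inverts [X] and [Y]. *)
Definition gen_triple (N : nat) (X Y J : {'GL_2[F]}) :=
  [/\ X \in SL2 F /\ Y \in SL2 F, SL2 F \subset <<[set X; Y]>>,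
      [/\ bar X ^+ N = 1, bar Y ^+ N = 1 & bar (X * Y) ^+ N = 1],
      ((#[bar X]%:R^-1 + #[bar Y]%:R^-1 + #[bar (X * Y)]%:R^-1 < 1 :> rat)%R)
    & X ^ J = X^-1 /\ Y ^ J = Y^-1].

Lemma gen_triple_hyperbolic N X Y J : gen_triple N X Y J ->
  hyperbolic_generating_triple (L2 F) (bar X) (bar Y) (bar (X * Y))^-1.
Proof.
case=> [[SX SY]] gXY _ hyp _; have Nx := norm_pmI X; have Ny := norm_pmI Y.
split; last by rewrite orderV.
  apply/eqP; rewrite eqEsubset gen_subG; apply/andP; split.
    apply/subsetP=> z; rewrite !inE -orbA => /or3P[]/eqP->; rewrite ?groupV;
      exact: mem_quotient (groupM SX SY) || exact: mem_quotient.
  apply: subset_trans (quotientS _ gXY) _.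
  have sN : [set X; Y] \subset 'N(pmI F) by apply/subsetP=> z _; exact: norm_pmI.
  rewrite quotient_gen // genS //; apply/subsetP=> _ /morphimP[z _ zXY ->].
  by move: zXY; rewrite !inE => /orP[]/eqP->; rewrite eqxx ?orbT.
by rewrite -morphM // mulgV.
Qed.

Lemma gen_triple_powers N X Y J : gen_triple N X Y J ->
  {in [set bar X; bar Y; (bar (X * Y))^-1], forall z, z ^+ N = 1}.
Proof.
case=> _ _ [xN yN zN] _ _ z; rewrite !inE -orbA => /or3P[]/eqP-> //.
by rewrite expgVn zN invg1.
Qed.

Definition bar_aut (J : {'GL_2[F]}) : {perm coset_of (pmI F)} :=
  conj_aut (L2 F) (bar J).

Lemma bar_norm_L2 J : bar J \in 'N(L2 F).
Proof.
apply: (subsetP (quotient_norm (pmI_group F) (SL2 F))).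
by apply: mem_morphim; [exact: norm_pmI | exact: norm_SL2].
Qed.

Lemma bar_autE J X : X \in SL2 F -> X ^ J = X^-1 -> bar_aut J (bar X) = (bar X)^-1.
Proof.
move=> SX XJ; rewrite /bar_aut norm_conj_autE ?bar_norm_L2 ?mem_quotient //.
by rewrite -morphJ ?norm_pmI // XJ morphV ?norm_pmI.
Qed.

(** Coprime exponents separate the powers of the two triples, and the
    condition on [J1] and [J2] makes the two automorphisms differ by an inner
    one. *)
Lemma admits_of_gen_triples N1 N2 X1 Y1 J1 X2 Y2 J2 :
  coprime N1 N2 -> gen_triple N1 X1 Y1 J1 -> gen_triple N2 X2 Y2 J2 ->
  J1^-1 * J2 \in SL2 F -> admits_strongly_real_beauville (L2 F).
Proof.
move=> co T1 T2 SJ.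
exists (bar X1), (bar Y1), (bar (X1 * Y1))^-1, (bar X2), (bar Y2), (bar (X2 * Y2))^-1.
split; first split.
- exact: gen_triple_hyperbolic T1.
- exact: gen_triple_hyperbolic T2.
- apply: nonconjugate_powers_coprime co _ _.
    exact: gen_triple_powers T1.
  exact: gen_triple_powers T2.
have AutJ J : bar_aut J \in Aut (L2 F).
  apply: (subsetP (Aut_conj_aut (L2 F) 'N(L2 F))).
  by apply: mem_morphim; exact: bar_norm_L2.
case: T1 T2 => [[SX1 SY1] _ _ _ [E1 E1']] [[SX2 SY2] _ _ _ [E2 E2']].
exists (bar_aut J1), (bar_aut J2); split; rewrite ?AutJ //.
- rewrite -morphV ?bar_norm_L2 // -morphM ?groupV ?bar_norm_L2 //.
  rewrite -morphV ?norm_pmI // -morphM ?groupV ?norm_pmI //.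
  apply: mem_morphim; last exact: mem_quotient.
  by rewrite bar_norm_L2.
- by constructor 1; rewrite !bar_autE.
- by constructor 1; rewrite !bar_autE.
Qed.

End Assembly.

Local Close Scope group_scope.
Local Open Scope ring_scope.

Section Triples.
Variable F : finFieldType.
Local Notation bar g := (coset (pmI F) g).

Lemma SL2_sub_gen a b c d a' b' c' d' :
  a * d - b * c = 1 -> a' * d' - b' * c' = 1 ->
  (forall P, subgroup_pred P -> P a b c d -> P a' b' c' d' -> full_pred P) ->
  SL2 F \subset <<[set gl2 a b c d; gl2 a' b' c' d']>>%g.
Proof.
move=> D D' full; set K := <<_>>%g.
pose P (x y z t : F) := (x * t - y * z == 1) && (gl2 x y z t \in K).
have sP : subgroup_pred P.
  split.
  - by rewrite /P gl2_1 group1 andbT; apply/eqP; ring.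
  - by move=> x y z t /andP[/eqP].
  - move=> x y z t /andP[/eqP E Kx]; rewrite /P -gl2V // groupV Kx andbT -E.
    by apply/eqP; ring.
  move=> x y z t x' y' z' t' /andP[/eqP E Kx] /andP[/eqP E' Kx'].
  rewrite /P -gl2M ?det1_neq0 // groupM // andbT; apply/eqP.
  by apply: (eq_from_scaled_eq (k := x' * t' - y' * z') E); rewrite -[X in _ - X = _]E'; ring.
have Pf : full_pred P.
  by apply: full sP _ _; rewrite /P ?D ?D' eqxx mem_gen // !inE eqxx ?orbT.
apply/subsetP=> g /SL2P[x [y [z [t [/Pf/andP[_ Kx] ->]]]]]; exact: Kx.
Qed.

(** For 2 x 2 matrices, the adjugate of a traceless matrix is its opposite.
    As [J] and [X J] are traceless, [X J = - adj (X J) = - adj J adj X = J X^-1].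
    The hypothesis on the entries says that [X J] is traceless. *)
Lemma conj_traceless (a b c d p q r : F) : a * d - b * c = 1 -> p * - p - q * r != 0 ->
  (a - d) * p + b * r + c * q = 0 ->
  (gl2 a b c d ^ gl2 p q r (- p) = (gl2 a b c d)^-1)%g.
Proof.
move=> D DJ tr0; apply: (mulgI (gl2 p q r (- p))); rewrite -conjgC.
have D0 := det1_neq0 D.
have DV : d * a - - b * - c != 0 by apply: det1_neq0; rewrite -D; ring.
rewrite gl2V // (gl2M D0 DJ) (gl2M DJ DV).
by congr (gl2 _ _ _ _); apply/eqP; rewrite -subr_eq0; apply/eqP;
  [rewrite -tr0 | idtac | idtac | rewrite -tr0]; ring.
Qed.

Lemma nonscalar_trace (a b c d : F) : a * d - b * c = 1 -> (a + d) ^+ 2 != 4%:R ->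
  nonscalar a b c d.
Proof.
move=> D; apply: contraNT; rewrite !negb_or !negbK => /and3P[/eqP b0 /eqP c0 /eqP ad].
apply/eqP; apply: (eq_from_scaled_eq (k := 4%:R) D).
by rewrite ad b0 c0; ring.
Qed.

Lemma order_bar_ge (a b c d : F) n : a * d - b * c = 1 -> nonscalar a b c d ->
  (forall k, (0 < k < n)%N -> (cheb (a + d) k).1 != 0) ->
  (n <= #[bar (gl2 a b c d)]%g)%N.
Proof.
by move=> D nsc H; apply: order_ge => k kn; rewrite bar_expn_eq1 // H.
Qed.

(** By [conj_traceless] and [bar_expn_eq1], everything but generation is a
    condition on the entries of the matrices and on the three traces. *)
Lemma gen_triple_gl2 N (a b c d a' b' c' d' p q r : F) :
  let X := gl2 a b c d in let Y := gl2 a' b' c' d' in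
  let Z := gl2 (a * a' + b * c') (a * b' + b * d') (c * a' + d * c') (c * b' + d * d') in
  a * d - b * c = 1 -> a' * d' - b' * c' = 1 ->
  (forall P, subgroup_pred P -> P a b c d -> P a' b' c' d' -> full_pred P) ->
  p * - p - q * r != 0 ->
  (a - d) * p + b * r + c * q = 0 -> (a' - d') * p + b' * r + c' * q = 0 ->
  (cheb (a + d) N).1 = 0 -> (cheb (a' + d') N).1 = 0 ->
  (cheb (a * a' + b * c' + (c * b' + d * d')) N).1 = 0 ->
  ((#[bar X]%g)%:R^-1 + (#[bar Y]%g)%:R^-1 + (#[bar Z]%g)%:R^-1 < 1 :> rat) ->
  gen_triple N X Y (gl2 p q r (- p)).
Proof.
move=> X Y Z D D' full DJ trX trY nX nY nZ hyp.
have EZ : Z = (X * Y)%g by rewrite /X /Y gl2M ?det1_neq0.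
have DZ : (a * a' + b * c') * (c * b' + d * d') -
          (a * b' + b * d') * (c * a' + d * c') = 1.
  by apply: (eq_from_scaled_eq (k := a' * d' - b' * c') D);
     rewrite -[X in _ - X = _]D'; ring.
split.
- by split; exact: gl2_SL2.
- exact: SL2_sub_gen.
- by rewrite -EZ; split; exact: bar_expn1.
- by rewrite -EZ.
- by split; exact: conj_traceless.
Qed.

Lemma gl2_det_eq (J1 J2 : {'GL_2[F]}) : \det (GLval J1) = \det (GLval J2) ->
  (J1^-1 * J2)%g \in SL2 F.
Proof.
by move=> E; rewrite inE det_GLM -E -det_GLM mulVg GL_1E det1.
Qed.

End Triples.

(** * The triple on the split torus *)

Section SplitTriple.
Variable F : finFieldType.
Local Notation q := #|F|.
Hypotheses (q8 : (8 <= q)%N) (q9 : q <> 9%N).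
Variable a : F.
Hypothesis a_prim : q.-1.-primitive_root a.

Lemma gen_neq0 : a != 0.
Proof.
apply/eqP => a0; have := prim_expr_order a_prim.
have -> : q.-1 = q.-2.+1 by case: q q8 => [|[]].
by rewrite a0 exprS mul0r => /eqP; rewrite eq_sym oner_eq0.
Qed.

(** The order q - 1 of [a] is at least 7 and different from 8. *)
Lemma gen_expf_neq1 k : (0 < k <= 8)%N -> k != 7 -> a ^+ k != 1.
Proof.
move=> kle k7; rewrite -(prim_order_dvd a_prim); apply/negP => dv.
have := dvdn_leq _ dv; have [m Em] := dvdnP dv; nia.
Qed.

Lemma gen_split_powers (P : F -> F -> F -> F -> bool) : subgroup_pred P ->
  P a 0 0 a^-1 -> forall k, k != 0 -> P k 0 0 k^-1.
Proof.
move=> sP Pa k k0; have a0 := gen_neq0.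
have /(prim_rootP a_prim)[n ->] := expf_card_pred k0.
elim: (n : nat) => [|m IH].
  by apply: (eq_sgp (sgp1 sP)); rewrite ?expr0 ?invr1.
apply: (eq_sgp (sgpM sP IH Pa)); rewrite ?exprSr; first [ring | field].
by rewrite a0 expf_neq0.
Qed.

(** Up to nonzero squares, [g^2 - M g + 1] is the opposite of the discriminant
    [4 - x^2 - y^2 - z^2 + x y z] of the traces [x = y = a + 1/a] and
    [z = g + 1/g], and [y] below is the square root that the symmetric shape of
    the second generator requires.  The conic [y^2 = g^2 - M g + 1] is
    parametrized by [y = g + k], that is [g = (1 - k^2)/(2 k + M)]; the
    conditions exclude at most nine values of [k], and q >= 11 when q is odd.
    In characteristic 2 every element is a square, and [g = a] will do. *)
Lemma exists_square_discriminant (M : F) : M = a ^+ 2 + a ^- 2 -> exists g y : F,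
  [/\ g != 0, g ^+ 2 != 1, y != 0 & g ^+ 2 - M * g + 1 = y ^+ 2].
Proof.
move=> EM; have a0 := gen_neq0.
have [two0|two0] := eqVneq (2%:R : F) 0.
  have [y Ey] := char2_sqrt two0 (a ^+ 2 - M * a + 1).
  exists a, y; split=> //; first exact: (gen_expf_neq1 (k := 2)).
  rewrite -sqrf_eq0 -Ey EM.
  have -> : a ^+ 2 - (a ^+ 2 + a ^- 2) * a + 1 = - a^-1 * (a - 1) * (a ^+ 3 - 1) .
    by field.
  rewrite !mulf_neq0 ?oppr_eq0 ?invr_eq0 ?subr_eq0 ?(gen_expf_neq1 (k := 3)) //.
  exact: (gen_expf_neq1 (k := 1)).
have q11 : (11 <= q)%N.
  have [p p_pr pF] := finPcharP F.
  have [k qk] := p_natP (pnat_card pF).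
  have podd : odd p.
    by case: (even_prime p_pr) => // p2; move: pF; rewrite p2 inE (negbTE two0).
  have qodd : odd q by rewrite qk oddX podd orbT.
  by case: q q8 q9 qodd => [|[|[|[|[|[|[|[|[|[|[|m]]]]]]]]]]].
(* The factors are the numerators and denominators of g, g^2 - 1 and y. *)
pose Q : {poly F} := Poly [:: M; 2%:R] * Poly [:: -1; 0; 1] *
  Poly [:: M - 1; 2%:R; 1] * Poly [:: - 1 - M; - 2%:R; 1] * Poly [:: 1; M; 1].
have Q0 : Q != 0.
  have nz (s : seq F) n : s`_n != 0 -> Poly s != 0.
    by move=> sn; apply: contraNneq sn => P0; rewrite -coef_Poly P0 coef0.
  by rewrite !mulf_neq0 //; [apply: (nz _ 1%N) | apply: (nz _ 2%N).. ] => //=; exact: oner_neq0.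
have sQ : (size Q <= (1 + 2 + 2 + 2 + 2).+1)%N.
  have sM (A B : {poly F}) n m : (size A <= n.+1)%N -> (size B <= m.+1)%N ->
      (size (A * B)%R <= (n + m).+1)%N.
    by move=> sA sB; apply: leq_trans (size_polyMleq _ _) _; lia.
  by do 4!(apply: (sM _ _ _ _); last exact: size_Poly); exact: size_Poly.
have [k Qk] : exists k, Q.[k] != 0.
  apply/existsP; rewrite -[[exists _, _]]negbK negb_exists; apply/negP => /forallP all0.
  have := @max_poly_roots _ Q (enum F) Q0 _ (enum_uniq F).
  rewrite -cardE => H; have : (q < size Q)%N; last by lia.
  by apply: H; apply/allP => x _; rewrite rootE; have := all0 x; rewrite negbK.
move: Qk; rewrite /Q !hornerM !horner_Poly /= !mulf_eq0 !negb_or !mul0r !add0r.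
case/andP=> /andP[/andP[/andP[k1 k2] k3] k4] k5.
exists ((1 - k ^+ 2) / (2%:R * k + M)), ((1 - k ^+ 2) / (2%:R * k + M) + k); split.
- rewrite mulf_neq0 ?invr_eq0 // -oppr_eq0.
  by move: k2; congr (_ != 0); ring.
- rewrite -subr_eq0 [X in X != 0](_ : _ = ((1 * k + 2%:R) * k + (M - 1)) *
    ((1 * k - 2%:R) * k + (- 1 - M)) / (2%:R * k + M) ^+ 2); last by field.
  by rewrite !mulf_neq0 ?invr_eq0 ?expf_neq0.
- rewrite [X in X != 0](_ : _ = ((1 * k + M) * k + 1) / (2%:R * k + M)); last by field.
  by rewrite mulf_neq0 ?invr_eq0.
- by field.
Qed.

Let t := a + a^-1.

(** The matrices are [diag(a, 1/a)] and [(r, w; -w, u)], where [r] and [u] are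
    determined by the traces [a + 1/a] of the second one and [g + 1/g] of the
    product, and [w] by the determinant.  Both are inverted by
    [(0, 1; 1, 0)]. *)
Lemma exists_split_triple N : (q.-1 %| 2 * N)%N ->
  exists X Y : {'GL_2[F]}, gen_triple N X Y (gl2 0 1 1 (- 0)).
Proof.
move=> dvN; have a0 := gen_neq0.
have [g [y [g0 g1 y0 Ey]]] := exists_square_discriminant (erefl (a ^+ 2 + a ^- 2)).
have a1 : a ^+ 2 != 1 by exact: (gen_expf_neq1 (k := 2)).
have a1' : a ^+ 2 - 1 != 0 by rewrite subr_eq0.
have g11 : g - 1 != 0.
  by apply: contra g1; rewrite subr_eq0 => /eqP->; rewrite expr1n.
pose v := a - a^-1.
have v0 : v != 0.
  have -> : v = (a ^+ 2 - 1) / a by rewrite /v; field.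
  by rewrite mulf_neq0 ?invr_eq0.
pose c := g + g^-1.
pose r := (c - 1 - a ^- 2) / v.
pose u := (a ^+ 2 + 1 - c) / v.
pose w := (g - 1) * y / (g * v).
have Eru : r + u = t by rewrite /r /u /t /v; field; rewrite a0.
have w0 : w != 0 by rewrite !mulf_neq0 ?invr_neq0 ?mulf_neq0.
have Ew : w ^+ 2 = (g - 1) ^+ 2 * (g ^+ 2 - (a ^+ 2 + a ^- 2) * g + 1) / (g * v) ^+ 2.
  by rewrite Ey /w; field; rewrite v0.
have Dy : r * u - w * - w = 1.
  have -> : r * u - w * - w = r * u + w ^+ 2 by ring.
  by rewrite Ew /r /u /c /v; field; rewrite a0 g0 -[a * a]expr2 a1'.
have Dx : a * a^-1 - 0 * 0 = 1 by rewrite mulr0 subr0 divff.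
have t0 : t != 0.
  have -> : t = (a ^+ 2 + 1) / a by rewrite /t; field.
  rewrite mulf_neq0 ?invr_eq0 //; apply/negP => /eqP E.
  have := @gen_expf_neq1 4 isT isT; rewrite -subr_eq0 => /negP; apply; apply/eqP.
  by rewrite [LHS](_ : _ = (a ^+ 2 - 1) * (a ^+ 2 + 1)); [rewrite E mulr0 | ring].
exists (gl2 a 0 0 a^-1), (gl2 r w (- w) u).
have expN (e : F) : e != 0 -> e ^+ (2 * N) = 1.
  by move=> e0; have [m ->] := dvdnP dvN; rewrite mulnC exprM expf_card_pred ?expr1n.
have chebN (e : F) : e != 0 -> e ^+ 2 != 1 -> (cheb (e + e^-1) N).1 = 0.
  by move=> e0 e1; apply/eqP; rewrite cheb_eq0 // expN.
have tr4 (e : F) : e != 0 -> e ^+ 2 != 1 -> (e + e^-1) ^+ 2 != 4%:R.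
  move=> e0 e1; rewrite -subr_eq0.
  rewrite [X in X != 0](_ : _ = ((e ^+ 2 - 1) / e) ^+ 2); last by field.
  by rewrite expf_neq0 // mulf_neq0 ?invr_eq0 ?subr_eq0.
have order5 k : (0 < k < 5)%N -> (cheb t k).1 != 0.
  move=> kb; rewrite /t cheb_eq0 //; apply: gen_expf_neq1; lia.
have Etr : a * r + 0 * - w + (0 * w + a^-1 * u) = c.
  by rewrite /r /u /c /v; field; rewrite a0 g0.
apply: gen_triple_gl2 => //.
- move=> P sP Px Py; apply: (full_split sP (gen_split_powers sP Px) Py w0).
    by rewrite Eru.
  by exists a => //; exact: (@gen_expf_neq1 8).
- by rewrite mul0r sub0r mulr1 oppr_eq0 oner_neq0.
- by ring.
- by ring.
- exact: chebN.
- by rewrite Eru; exact: chebN.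
- by rewrite Etr; exact: chebN.
apply: hyperbolic_552.
- by apply: order_bar_ge => //; apply: nonscalar_trace => //; exact: tr4.
- by apply: order_bar_ge; rewrite ?Eru //; apply: nonscalar_trace; rewrite ?Eru //; exact: tr4.
have DZ : (a * r + 0 * - w) * (0 * w + a^-1 * u) - (a * w + 0 * u) * (0 * r + a^-1 * - w) = 1.
  by rewrite -[RHS]Dy; field.
apply: order_bar_ge => //; last by case=> [|[|k]] // _; rewrite /= mul0r add0r oner_neq0.
by apply: nonscalar_trace; rewrite ?Etr //; exact: tr4.
Qed.

End SplitTriple.

(** * The triple on the nonsplit torus *)

Lemma cheb_two (R : comPzRingType) n : cheb (2%:R : R) n = (n%:R, 1 - n%:R).
Proof.
elim: n => [|n IH] /=; first by rewrite subr0.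
by rewrite IH /= -[n.+1]addn1 natrD; congr pair; ring.
Qed.

Lemma hyperbolic_525 l m n : (5 <= l)%N -> (2 <= m)%N -> (5 <= n)%N ->
  l%:R^-1 + m%:R^-1 + n%:R^-1 < 1 :> rat.
Proof. by move=> l5 m2 n5; rewrite addrAC hyperbolic_552. Qed.

Section NonsplitTriple.
Variable F : finFieldType.
Local Notation q := #|F|.
Hypotheses (q8 : (8 <= q)%N) (q9 : q <> 9%N).

(** The matrices are [c = (0, -1; 1, s)], of order q + 1, and the transvection
    [z = (1, l; 0, 1)]; both are inverted by [(1, s; 0, -1)].  The parameter [l] is
    chosen so that [c z], of trace [l + s], has the same order in L2 as [c]. *)
Lemma exists_nonsplit_triple p N : p \in [pchar F] -> (q.+1 %| 2 * N)%N ->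
  (p %| N)%N ->
  exists (s : F) (X Y : {'GL_2[F]}), gen_triple N X Y (gl2 1 s 0 (- 1)).
Proof.
move=> pF dvN pN; have [K [f [u [s [u_prim s_tr]]]]] := exists_nonsplit_trace F.
have u0 := prim_neq0 u_prim.
have uN k : (u ^+ k == 1) = (q.+1 %| k)%N by rewrite -(prim_order_dvd u_prim).
have s0 := prim_trace_neq0 u_prim s_tr (ltnW (ltnW q8)).
have u2 : u ^+ 2 != 1 by rewrite uN; apply/negP => /(@dvdn_leq _ 2 isT); lia.
have chebs k : ((cheb s k).1 == 0) = (q.+1 %| 2 * k)%N.
  by rewrite -uN -cheb_eq0 // -s_tr rmorph_cheb fmorph_eq0.
have order5 k : (0 < k < 5)%N -> (cheb s k).1 != 0.
  by move=> kb; rewrite chebs; apply/negP => /dvdn_leq; lia.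
have [l [l0 Pl nls lorder]] : exists l : F, [/\ l != 0,
   (l = - (2%:R * s) /\ 2%:R != 0 :> F) \/ (2 \in [pchar F] /\ l = s ^+ 2 + s /\ s != 1),
   (cheb (l + s) N).1 = 0 & forall k, (0 < k < 5)%N -> (cheb (l + s) k).1 != 0].
  have [two0|two0] := eqVneq (2%:R : F) 0.
    have char2 : 2 \in [pchar F] by rewrite inE /= two0.
    have s1 : s != 1.
      apply/eqP => s1; have two0K : 2%:R = 0 :> K by rewrite -(rmorph_nat f) two0 rmorph0.
      have E : u + u^-1 = 1 by rewrite -s_tr s1 rmorph1.
      have u3 : u ^+ 3 = - 1 by apply: (eq_from_scaled_eq (k := u * (u + 1)) E); field.
      have : u ^+ 3 == 1.
        by rewrite u3; apply/eqP/(eq_from_scaled_eq (k := - 1) two0K); ring.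
      by rewrite uN => /(@dvdn_leq _ 3 isT); lia.
    have Es2 : s ^+ 2 + s + s = s ^+ 2.
      by apply: (eq_from_scaled_eq (k := s) two0); ring.
    have qeven : ~~ odd q.
      by rewrite -dvdn2 (dvdn_pcharf char2) card_natr0.
    have chebs2 k : ((cheb (s ^+ 2) k).1 == 0) = (q.+1 %| k)%N.
      rewrite -(fmorph_eq0 f) -[f _]/((f (cheb (s ^+ 2) k).1, f (cheb (s ^+ 2) k).2).1).
      rewrite -rmorph_cheb rmorphXn /= s_tr.
      have -> : (u + u^-1) ^+ 2 = u ^+ 2 + (u ^+ 2)^-1.
        have two0K : 2%:R = 0 :> K by rewrite -(rmorph_nat f) two0 rmorph0.
        by apply: (eq_from_scaled_eq (k := 1) two0K); field.
      rewrite cheb_eq0 ?expf_neq0 // -?exprM ?uN.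
        by rewrite mulnA Gauss_dvdr // (@coprime_pexpr 2 _ 2) // coprimen2 /= qeven.
      by apply/negP => /(@dvdn_leq _ 4 isT); lia.
    exists (s ^+ 2 + s); split=> //.
    - have -> : s ^+ 2 + s = s * (s - 1).
        by apply: (eq_from_scaled_eq (k := s) two0); ring.
      by rewrite mulf_neq0 // subr_eq0.
    - by right.
    - rewrite Es2; apply/eqP; rewrite chebs2 -(Gauss_dvdr _ (_ : coprime _ 2)) //.
      by rewrite coprimen2 /= qeven.
    by move=> k kb; rewrite Es2 chebs2; apply/negP => /dvdn_leq; lia.
  have chebNs k : ((cheb (- s) k).1 == 0) = (q.+1 %| 2 * k)%N.
    rewrite -(fmorph_eq0 f) -[f _]/((f (cheb (- s) k).1, f (cheb (- s) k).2).1).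
    rewrite -rmorph_cheb rmorphN /= s_tr opprD -invrN.
    by rewrite cheb_eq0 ?oppr_eq0 ?sqrrN // exprM sqrrN -exprM uN.
  exists (- (2%:R * s)); split=> //.
  - by rewrite oppr_eq0 mulf_neq0.
  - by left.
  - by apply/eqP; rewrite (_ : _ + s = - s) ?chebNs //; ring.
  by move=> k kb; rewrite (_ : _ + s = - s) ?chebNs -?chebs ?order5 //; ring.
have Ns : nonscalar 0 (-1) 1 s by rewrite /nonscalar oner_neq0 orbT.
exists s, (gl2 0 (- 1) 1 s), (gl2 1 l 0 1).
have EZ : 0 * l + -1 * 1 = - 1 by ring.
apply: gen_triple_gl2.
- by ring.
- by ring.
- by move=> P sP Pc Pz; apply: (full_nonsplit sP u_prim s_tr _ Pc Pz q9 Pl); exact: ltnW (ltnW q8).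
- by rewrite mulr0 subr0 mulrN1 oppr_eq0 oner_neq0.
- by ring.
- by ring.
- by rewrite add0r; apply/eqP; rewrite chebs.
- by rewrite cheb_two /=; apply/eqP; rewrite -(dvdn_pcharf pF).
- by rewrite -[RHS]nls; congr (cheb _ N).1; ring.
apply: hyperbolic_525.
- by apply: order_bar_ge; rewrite ?add0r //; ring.
- apply: order_bar_ge; first by ring.
    by rewrite /nonscalar l0.
  by case=> [|[|k]] // _; rewrite /= mul0r add0r oner_neq0.
have D : (0 * 1 + -1 * 0) * (1 * l + s * 1) - (0 * l + -1 * 1) * (1 * 1 + s * 0) = 1 :> F by ring.
apply: order_bar_ge => //.
  by rewrite /nonscalar EZ oppr_eq0 oner_neq0.
move=> k kb; rewrite [X in cheb X](_ : _ = l + s); last by ring.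
exact: lorder.
Qed.

End NonsplitTriple.

(** * Explicit triples over the fields with seven and nine elements *)

Lemma order4_trace_sqr2 (F : finFieldType) (t : F) : t ^+ 2 = 2%:R -> (cheb t 4).1 = 0.
Proof.
move=> t2; apply: (eq_from_scaled_eq (k := t) t2); rewrite /=; ring.
Qed.

(** The coefficients for n = 1, 2, 3 are 1, [t] and [t^2 - 1]. *)
Lemma order_bar_ge4 (F : finFieldType) (a b c d : F) : a * d - b * c = 1 ->
  nonscalar a b c d -> a + d != 0 -> (a + d) ^+ 2 != 1 ->
  (4 <= #[coset (pmI F) (gl2 a b c d)]%g)%N.
Proof.
move=> D nsc t0 t1; apply: order_bar_ge => // k; set t := a + d in t0 t1 *.
case: k => [|[|[|[|k]]]] //= _.
- by rewrite mul0r add0r oner_neq0.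
- by rewrite mul0r add0r mul1r oppr0 addr0.
- by rewrite [X in X != 0](_ : _ = t ^+ 2 - 1) ?subr_eq0 //; ring.
Qed.

(** An additive subgroup of F with more than q/p elements is F. *)
Lemma uppers_full_card (F : finFieldType) (P : F -> F -> F -> F -> bool)
    (Psub : subgroup_pred P) (p k : nat) (s : seq F) :
  prime p -> #|F| = (p ^ k.+1)%N -> uniq s -> {subset s <= uppers P} ->
  (p ^ k < size s)%N -> forall v, v \in uppers P.
Proof.
move=> p_pr qk us sV ks.
have dvV : (#|uppers P| %| #|F|)%N.
  by apply: card_addsubgroup_dvd; [exact: uppers0 | move=> x y; exact: uppersD].
have big : (p ^ k < #|uppers P|)%N.
  apply: leq_trans ks _; rewrite -(card_uniqP us); apply/subset_leq_card/subsetP.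
  exact: sV.
have VF : #|uppers P| = #|F|.
  move: dvV big; rewrite qk => /(dvdn_pfactor _ _ p_pr)[m mk ->].
  by rewrite ltn_exp2l ?prime_gt1 // => km; congr expn; lia.
move=> v; have /subset_cardP H := VF.
by rewrite (H _) ?inE //; apply/subsetP.
Qed.

Section Seven.
Variable F : finFieldType.
Hypothesis q7 : #|F| = 7%N.

Lemma seven_eq0 : 7%:R = 0 :> F.
Proof. by rewrite -q7 card_natr0. Qed.

Lemma natr_neq0_mod7 n : ~~ (7 %| n)%N -> n%:R != 0 :> F.
Proof.
have char7 : 7 \in [pchar F] by rewrite inE /= seven_eq0 eqxx.
by rewrite (dvdn_pcharf char7).
Qed.

Lemma eq_mod7 (c x y : F) : x - y = 7%:R * c -> x = y.
Proof. exact: eq_of_natr0 seven_eq0. Qed.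

Lemma neq0_mod7 n (x : F) : ~~ (7 %| n)%N -> x = n%:R -> x != 0.
Proof. by move=> n7 ->; exact: natr_neq0_mod7. Qed.

(** Over a prime field, an upper and a lower transvection generate SL2; the
    lower one is chosen so that the product has trace [5 = - 2]. *)
Lemma gen_triple_777 : exists X Y : {'GL_2[F]}, gen_triple 7 X Y (gl2 1 0 0 (- 1)).
Proof.
have n3 : 3%:R != 0 :> F by exact: natr_neq0_mod7.
exists (gl2 1 1 0 1), (gl2 1 0 3%:R 1); apply: gen_triple_gl2.
- by ring.
- by ring.
- move=> P sP Px Py; apply: (full_of_uppers sP _ Py n3).
  apply: (@uppers_full_card _ _ sP 7 0 [:: 0; 1]); rewrite ?q7 //=.
    by rewrite inE eq_sym oner_eq0.
  by move=> v; rewrite !inE => /orP[]/eqP ->; rewrite ?(sgp1 sP).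
- by rewrite mulr0 subr0 mulrN1 oppr_eq0 oner_neq0.
- by ring.
- by ring.
- by apply: (eq_mod7 (c := 1)); rewrite /=; ring.
- by apply: (eq_mod7 (c := 1)); rewrite /=; ring.
- by apply: (eq_mod7 (c := 1807%:R)); rewrite /=; ring.
apply: hyperbolic_444; apply: order_bar_ge4.
- by ring.
- by rewrite /nonscalar oner_neq0.
- by apply: (@neq0_mod7 2) => //; ring.
- by rewrite -subr_eq0; apply: (@neq0_mod7 3) => //; ring.
- by ring.
- by rewrite /nonscalar n3 orbT.
- by apply: (@neq0_mod7 2) => //; ring.
- by rewrite -subr_eq0; apply: (@neq0_mod7 3) => //; ring.
- by ring.
- by rewrite /nonscalar mul1r mulr1 mul0r add0r oner_neq0 ?orbT.
- by apply: (@neq0_mod7 5) => //; ring.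
- by rewrite -subr_eq0; apply: (@neq0_mod7 24) => //; ring.
Qed.

(** The traces 3, 3 and [4 = - 3] are square roots of 2, which is what order 4
    in L2 means.  For the generators [X] and [Y], the square of [X^-1 Y X^-1] is a
    transvection. *)
Lemma gen_triple_444_mod7 :
  exists X Y : {'GL_2[F]}, gen_triple 4 X Y (gl2 1 3%:R 0 (- 1)).
Proof.
exists (gl2 0 (- 1) 1 3%:R), (gl2 1 3%:R 5%:R 2%:R); apply: gen_triple_gl2.
- by ring.
- by apply: (eq_mod7 (c := - 2%:R)); ring.
- move=> P sP Px Py; apply: (full_of_uppers sP _ Px (oner_neq0 _)).
  have PA := sgpM sP (sgpM sP (sgpV sP Px) Py) (sgpV sP Px).
  have PB : P 1 (- 2%:R) 0 1.
    apply: (eq_sgp (sgpM sP PA PA)).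
    - by apply: (eq_mod7 (c := 24%:R)); ring.
    - by apply: (eq_mod7 (c := 14%:R)); ring.
    - by ring.
    - by ring.
  apply: (@uppers_full_card _ _ sP 7 0 [:: 0; - 2%:R]); rewrite ?q7 //=.
    by rewrite inE eq_sym oppr_eq0 natr_neq0_mod7.
  by move=> v; rewrite !inE => /orP[]/eqP ->; rewrite ?(sgp1 sP).
- by rewrite mulr0 subr0 mulrN1 oppr_eq0 oner_neq0.
- by ring.
- by apply: (eq_mod7 (c := 2%:R)); ring.
- by apply: order4_trace_sqr2; apply: (eq_mod7 (c := 1)); ring.
- by apply: order4_trace_sqr2; apply: (eq_mod7 (c := 1)); ring.
- by apply: order4_trace_sqr2; apply: (eq_mod7 (c := 2%:R)); ring.
apply: hyperbolic_444; apply: order_bar_ge4.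
- by ring.
- by rewrite /nonscalar oner_neq0 orbT.
- by apply: (@neq0_mod7 3) => //; ring.
- by rewrite -subr_eq0; apply: (@neq0_mod7 8) => //; ring.
- by apply: (eq_mod7 (c := - 2%:R)); ring.
- by rewrite /nonscalar natr_neq0_mod7.
- by apply: (@neq0_mod7 3) => //; ring.
- by rewrite -subr_eq0; apply: (@neq0_mod7 8) => //; ring.
- by apply: (eq_mod7 (c := - 2%:R)); ring.
- apply/or3P; constructor 2; apply: (@neq0_mod7 16) => //; ring.
- by apply: (@neq0_mod7 4) => //; ring.
- by rewrite -subr_eq0; apply: (@neq0_mod7 15) => //; ring.
Qed.

End Seven.

Section Nine.
Variable F : finFieldType.
Hypothesis q9 : #|F| = 9%N.

Lemma three_eq0 : 3%:R = 0 :> F.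
Proof.
have : (3%:R : F) ^+ 2 = 0 by rewrite -natrX -[RHS](card_natr0 F) q9.
by move/eqP; rewrite sqrf_eq0 => /eqP.
Qed.

(** Modulo 3, [X^4 + 1 = (X^2 + X - 1) (X^2 - X - 1)]; the elements of order 8
    are the roots of the first factor and their opposites. *)
Lemma exists_sqr_1sub : exists a : F, a ^+ 2 = 1 - a /\ 8.-primitive_root a.
Proof.
have [b] := exists_generator F; rewrite q9 /= => b_prim.
have b4 : b ^+ 4 = - 1.
  have /eqP := prim_expr_order b_prim; rewrite (exprM b 4 2) sqrf_eq1 => /orP[]/eqP //.
  by move/eqP; rewrite -(prim_order_dvd b_prim).
have : (b ^+ 2 - (1 - b)) * (b ^+ 2 - (1 + b)) = 0.
  by apply: (eq_from_scaled_eq (k := - b ^+ 2) three_eq0); ring: b4.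
move/eqP; rewrite mulf_eq0 !subr_eq0 => /orP[]/eqP E; first by exists b.
exists (b ^+ 5); split; last by rewrite prim_root_exp_coprime.
by rewrite (exprD b 4 1) b4 expr1 mulN1r opprK sqrrN.
Qed.

Variable a : F.
Hypotheses (aa : a ^+ 2 = 1 - a) (a_prim : 8.-primitive_root a).

Lemma eq_mod3 (c x y : F) : x - y = 3%:R * c -> x = y.
Proof. exact: eq_of_natr0 three_eq0. Qed.

(** [y] is an inverse of [x] modulo 3. *)
Lemma neq0_mod3 (y x c : F) : x * y - 1 = 3%:R * c -> x != 0.
Proof.
move/eq_mod3 => E; apply: contra_eq_neq E => ->.
by rewrite mul0r eq_sym oner_neq0.
Qed.

Lemma a_neq0 : a != 0.
Proof. by apply: (@neq0_mod3 (1 + a) _ 0); ring: aa. Qed.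

Lemma invr_mod3 : a^-1 = 1 + a.
Proof. by apply: (mulfI a_neq0); rewrite divff ?a_neq0 //; ring: aa. Qed.

(** Here [X = diag(a, 1/a)] generates the split torus, and [Y^-1 X^-1 Y] has lower
    right entry 0, so that [full_of_torus] applies.  The inverting matrix is
    scaled to have determinant [- a], like that of the other triple. *)
Lemma gen_triple_444_mod9 : exists X Y : {'GL_2[F]},
  gen_triple 4 X Y (gl2 0 (- (1 + a)) (a - 1) (- 0)).
Proof.
have sq2 : (2%:R + a) ^+ 2 = 2%:R by apply: (eq_mod3 (c := a + 1)); ring: aa.
exists (gl2 a 0 0 (1 + a)), (gl2 (1 + a) a 1 1); apply: gen_triple_gl2.
- by ring: aa.
- by ring.
- move=> P sP Px Py.
  have PT k : k != 0 -> P k 0 0 k^-1.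
    move=> k0; have := expf_card_pred k0; rewrite q9 => /(prim_rootP a_prim)[n ->].
    elim: (n : nat) => [|m IH].
      by apply: (eq_sgp (sgp1 sP)); rewrite ?expr0 ?invr1.
    apply: (eq_sgp (sgpM sP IH Px)); rewrite ?exprSr ?invfM ?invr_mod3; ring.
  have PA := sgpM sP (sgpM sP (sgpV sP Py) (sgpV sP Px)) Py.
  apply: (@full_of_torus _ _ sP (1 - a) a (2%:R - a) PT).
  - apply: (eq_sgp PA).
    + by apply: (eq_mod3 (c := a)); ring: aa.
    + by apply: (eq_mod3 (c := 0)); ring: aa.
    + by apply: (eq_mod3 (c := - 1)); ring: aa.
    + by apply: (eq_mod3 (c := 0)); ring: aa.
  - by apply: (@neq0_mod3 (a - 1) _ (a - 1)); ring: aa.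
  exists a; first exact: a_neq0.
  by rewrite -(prim_order_dvd a_prim).
- by apply: (@neq0_mod3 (- 1 - a) _ 0); ring: aa.
- by ring.
- by apply: (eq_mod3 (c := - a)); ring: aa.
- by apply: order4_trace_sqr2; apply: (eq_mod3 (c := 1)); ring: aa.
- by apply: order4_trace_sqr2; apply: (eq_mod3 (c := 1 + a)); ring: aa.
- by apply: order4_trace_sqr2; apply: (eq_mod3 (c := 1 + a)); ring: aa.
apply: hyperbolic_444; apply: order_bar_ge4.
- by ring: aa.
- by apply/or3P; constructor 3; rewrite -subr_eq0; apply: (@neq0_mod3 (- 1) _ 0); ring.
- by apply: (@neq0_mod3 (a - 1) _ (- a)); ring: aa.
- by rewrite -subr_eq0; apply: (@neq0_mod3 1 _ 1); ring: aa.
- by ring.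
- by rewrite /nonscalar a_neq0.
- by apply: (@neq0_mod3 (1 - a) _ 0); ring: aa.
- by rewrite -subr_eq0; apply: (@neq0_mod3 1 _ (1 + a)); ring: aa.
- by ring: aa.
- by apply/or3P; constructor 2; apply: (@neq0_mod3 a _ 0); ring: aa.
- by apply: (@neq0_mod3 (1 - a) _ 0); ring: aa.
- by rewrite -subr_eq0; apply: (@neq0_mod3 1 _ (1 + a)); ring: aa.
Qed.

(** For the generators [x] and [y] below, the words [x^-1 y^-1 x y y] and
    [y^-1 x y^-1 y^-1 x^-1] are transvections of parameters [a] and [a - 1], which
    span F over its prime field.  The partial products are reduced modulo 3 and
    [a^2 = 1 - a] at every step. *)
Lemma gen_triple_555_mod9 : exists X Y : {'GL_2[F]},
  gen_triple 5 X Y (gl2 a 2%:R (1 + a) (- a)).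
Proof.
exists (gl2 0 (- 1) 1 a), (gl2 a (1 + a) (a - 1) a); apply: gen_triple_gl2.
- by ring.
- by ring.
- move=> P sP Px Py; apply: (full_of_uppers sP _ Px (oner_neq0 _)).
  have Pu1 : P (- 1 + a) (- 1 + a) (- a) (1 + a).
    apply: (eq_sgp (sgpM sP (sgpV sP Px) (sgpV sP Py))).
    - by apply: (eq_mod3 (c := 1 + (- 1) * a)); ring: aa.
    - by apply: (eq_mod3 (c := 0)); ring: aa.
    - by apply: (eq_mod3 (c := 0)); ring: aa.
    - by apply: (eq_mod3 (c := 0)); ring: aa.
  have Pu2 : P (- 1 + a) (- 1) (1 + a) (1 + a).
    apply: (eq_sgp (sgpM sP Pu1 Px)).
    - by apply: (eq_mod3 (c := 0)); ring: aa.
    - by apply: (eq_mod3 (c := 1 + (- 1) * a)); ring: aa.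
    - by apply: (eq_mod3 (c := 0)); ring: aa.
    - by apply: (eq_mod3 (c := 0)); ring: aa.
  have Pu3 : P (- 1) a (1 - a) a.
    apply: (eq_sgp (sgpM sP Pu2 Py)).
    - by apply: (eq_mod3 (c := 1 + (- 1) * a)); ring: aa.
    - by apply: (eq_mod3 (c := 0 + (- 1) * a)); ring: aa.
    - by apply: (eq_mod3 (c := 0)); ring: aa.
    - by apply: (eq_mod3 (c := 1 + (0) * a)); ring: aa.
  have Pu4 : P 1 a 0 1.
    apply: (eq_sgp (sgpM sP Pu3 Py)).
    - by apply: (eq_mod3 (c := 0 + (- 1) * a)); ring: aa.
    - by apply: (eq_mod3 (c := 0 + (- 1) * a)); ring: aa.
    - by apply: (eq_mod3 (c := 0)); ring: aa.
    - by apply: (eq_mod3 (c := 0)); ring: aa.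
  have Pv1 : P (- 1 - a) (- 1 - a) a 0.
    apply: (eq_sgp (sgpM sP (sgpV sP Py) Px)).
    - by apply: (eq_mod3 (c := 0)); ring: aa.
    - by apply: (eq_mod3 (c := 0)); ring: aa.
    - by apply: (eq_mod3 (c := 0)); ring: aa.
    - by apply: (eq_mod3 (c := 0)); ring: aa.
  have Pv2 : P (- 1 - a) (1 + a) (1 - a) (- 1).
    apply: (eq_sgp (sgpM sP Pv1 (sgpV sP Py))).
    - by apply: (eq_mod3 (c := 0)); ring: aa.
    - by apply: (eq_mod3 (c := 0)); ring: aa.
    - by apply: (eq_mod3 (c := 0)); ring: aa.
    - by apply: (eq_mod3 (c := 0)); ring: aa.
  have Pv3 : P (- 1 + a) a 1 a.
    apply: (eq_sgp (sgpM sP Pv2 (sgpV sP Py))).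
    - by apply: (eq_mod3 (c := 0)); ring: aa.
    - by apply: (eq_mod3 (c := 1 + (0) * a)); ring: aa.
    - by apply: (eq_mod3 (c := - 1 + (1) * a)); ring: aa.
    - by apply: (eq_mod3 (c := 0 + (- 1) * a)); ring: aa.
  have Pv4 : P 1 (- 1 + a) 0 1.
    apply: (eq_sgp (sgpM sP Pv3 (sgpV sP Px))).
    - by apply: (eq_mod3 (c := 0 + (- 1) * a)); ring: aa.
    - by apply: (eq_mod3 (c := 0)); ring: aa.
    - by apply: (eq_mod3 (c := 0)); ring: aa.
    - by apply: (eq_mod3 (c := 0)); ring: aa.
  have Va : a \in uppers P by [].
  have V1 : 1 \in uppers P.
    by rewrite [1](_ : _ = a - (- 1 + a)) ?uppersD ?uppersN //; ring.
  apply: (@uppers_full_card _ _ sP 3 1 [:: 0; 1; a; - a]); rewrite ?q9 //.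
    rewrite /= !inE !negb_or !(eq_sym 0) oppr_eq0 oner_neq0 a_neq0 /= !andbT.
    rewrite -andbA; apply/and3P; split; rewrite -subr_eq0.
    - by apply: (@neq0_mod3 (a - 1) _ (a - 1)); ring: aa.
    - by apply: (@neq0_mod3 a _ 0); ring: aa.
    - by apply: (@neq0_mod3 (- 1 - a) _ (- 1)); ring: aa.
  move=> v; rewrite !inE => /or4P[]/eqP ->.
  - exact: (uppers0 sP).
  - exact: V1.
  - exact: Va.
  - exact: (uppersN sP Va).
- by apply: (@neq0_mod3 (- 1 - a) _ (1 + a)); ring: aa.
- by ring: aa.
- by apply: (eq_mod3 (c := a)); ring: aa.
- by apply: (eq_mod3 (c := 0)); rewrite /=; ring: aa.
- by apply: (eq_mod3 (c := 7%:R - 12%:R * a)); rewrite /=; ring: aa.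
- by apply: (eq_mod3 (c := 40%:R - 56%:R * a)); rewrite /=; ring: aa.
apply: hyperbolic_444; apply: order_bar_ge4.
- by ring.
- by rewrite /nonscalar oner_neq0 orbT.
- by rewrite add0r a_neq0.
- by rewrite -subr_eq0; apply: (@neq0_mod3 (- 1 - a) _ 0); ring: aa.
- by ring.
- by apply/or3P; constructor 1; apply: (@neq0_mod3 a _ 0); ring: aa.
- by apply: (@neq0_mod3 (- 1 - a) _ (- 1)); ring: aa.
- by rewrite -subr_eq0; apply: (@neq0_mod3 (- 1 - a) _ (- a)); ring: aa.
- by ring: aa.
- by apply/or3P; constructor 1; apply: (@neq0_mod3 (- 1 - a) _ 0); ring: aa.
- by apply: (@neq0_mod3 (- 1 - a) _ (- 1 - a)); ring: aa.
- by rewrite -subr_eq0; apply: (@neq0_mod3 (- 1 - a) _ (- 1 - 3%:R * a)); ring: aa.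
Qed.

End Nine.

(** * Fields with at most five elements *)

Section SmallFields.
Variable F : finFieldType.
Hypothesis q5 : (#|F| <= 5)%N.

(** The product of the three coefficients is [t (t^2 - 1) (t^4 - 3 t^2 + 1)],
    which is a multiple of [t^q - t] modulo the characteristic. *)
Lemma small_trace (t : F) :
  [\/ (cheb t 2).1 = 0, (cheb t 3).1 = 0 | (cheb t 5).1 = 0].
Proof.
have tq := expf_card t; have nq := card_natr0 F; have q2 := finNzRing_gt1 F.
have /eqP : (cheb t 2).1 * (cheb t 3).1 * (cheb t 5).1 = 0.
  have -> : (cheb t 2).1 * (cheb t 3).1 * (cheb t 5).1 =
    t * (t ^+ 2 - 1) * (t ^+ 4 - 3%:R * t ^+ 2 + 1) by rewrite /=; ring.
  move: q5 q2 tq nq; case: #|F| => [|[|[|[|[|[|n]]]]]] // _ _ tq nq.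
  - by apply: (eq_from_scaled_eq (k := (t + 1) * (t ^+ 4 - 3%:R * t ^+ 2 + 1)) tq); ring.
  - by apply: (eq_from_scaled_eq (k := t ^+ 4 - 3%:R * t ^+ 2 + 1) tq); ring.
  - apply: (eq_from_scaled_eq (k := - t ^+ 3 * (t ^+ 2 - 1)) nq).
    by apply: (eq_from_scaled_eq (k := t ^+ 3 + 1) tq); ring.
  apply: (eq_from_scaled_eq (k := - t ^+ 3 * (t ^+ 2 - 1)) nq).
  by apply: (eq_from_scaled_eq (k := t ^+ 2 + 1) tq); ring.
rewrite !mulf_eq0 -orbA => /or3P[]/eqP; [by constructor 1 | by constructor 2 | by constructor 3].
Qed.

Lemma order_gt3_eq5 x : x \in L2 F -> (3 < #[x]%g)%N -> #[x]%g = 5%N.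
Proof.
case/morphimP=> g Ng Sg -> o3.
have [a [b [c [d [D Eg]]]]] := SL2P Sg; move: o3; rewrite Eg.
have dv n : (cheb (a + d) n).1 = 0 -> (#[coset (pmI F) (gl2 a b c d)]%g %| n)%N.
  by move=> /(bar_expn1 D)/eqP; rewrite order_dvdn.
case: (small_trace (a + d)) => /dv dvo o3.
- by have := leq_trans o3 (@dvdn_leq _ 2 isT dvo).
- by have := leq_trans o3 (@dvdn_leq _ 3 isT dvo).
by apply/eqP; case/primeP: (isT : prime 5) => _ /(_ _ dvo)/orP[/eqP o1|//]; rewrite o1 in o3.
Qed.

Lemma order5_in_triple x y z : hyperbolic_generating_triple (L2 F) x y z ->
  exists2 w, w \in [set x; y; z] & w \in L2 F /\ #[w]%g = 5%N.
Proof.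
case=> gen _ hyp.
have inG w : w \in [set x; y; z] -> w \in L2 F by rewrite -gen; exact: mem_gen.
have [xS [yS zS]] : x \in [set x; y; z] /\ y \in [set x; y; z] /\ z \in [set x; y; z].
  by rewrite !inE !eqxx ?orbT.
have := hyperbolic_order_gt3 (order_gt0 x) (order_gt0 y) (order_gt0 z) hyp.
case/or3P=> o3; [exists x | exists y | exists z] => //;
  by split; [exact: inG | apply: order_gt3_eq5 (inG _ _) o3].
Qed.

Lemma logn5_L2 : (logn 5 #|L2 F| <= 1)%N.
Proof.
have dvGL : (#|L2 F| %| #|F| * #|F|.-1 ^ 2 * #|F|.+1)%N.
  rewrite -card_GL_2; apply: dvdn_trans (dvdn_quotient _ _) _.
  exact: cardSg (subsetT _).
have GL0 : (0 < #|F| * #|F|.-1 ^ 2 * #|F|.+1)%N.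
  by rewrite -card_GL_2 cardG_gt0.
apply: leq_trans (dvdn_leq_log 5 GL0 dvGL) _.
by move: q5 (finNzRing_gt1 F); case: #|F| => [|[|[|[|[|[|n]]]]]].
Qed.

(** An element of order 5 generates a Sylow subgroup. *)
Lemma not_beauville_small x1 y1 z1 x2 y2 z2 :
  ~ beauville_structure (L2 F) x1 y1 z1 x2 y2 z2.
Proof.
case=> /order5_in_triple[a aS [aG oa]] /order5_in_triple[b bS [bG ob]] nonconj.
have Syl w : w \in L2 F -> #[w]%g = 5%N -> (5.-Sylow(L2 F) <[w]>)%g.
  move=> wG ow; rewrite pHallE cycle_subG wG /= p_part -orderE ow.
  have : (5 %| #|L2 F|)%N by rewrite -ow order_dvdG.
  rewrite -[X in (X %| _)%N](expn1 5) pfactor_dvdn ?cardG_gt0 // => l1.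
  by rewrite (_ : logn _ _ = 1%N) //; apply/eqP; rewrite eqn_leq logn5_L2.
have [g gG Eb] := Sylow_trans (Syl a aG oa) (Syl b bG ob).
have : b \in (<[a]> :^ g)%g by rewrite -Eb cycle_id.
case/imsetP=> _ /cycleP[i ->] E.
have ai1 : (a ^+ i != 1)%g.
  by rewrite -(conjg_eq1 _ g) -E -order_eq1 ob.
by have := nonconj a b i 1%N aS bS ai1; rewrite expg1 E memJ_class.
Qed.

End SmallFields.

(** * Fields with more than five elements *)

Section LargeFields.
Variable F : finFieldType.
Local Notation q := #|F|.

(** For odd q the exponents are (q - 1)/2 and p (q + 1)/2, for even q they are
    q - 1 and p (q + 1). *)
Lemma admits_generic : (8 <= q)%N -> q <> 9%N -> admits_strongly_real_beauville (L2 F).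
Proof.
move=> q8 q9; have [p p_pr pF] := finPcharP F.
have pq : (p %| q)%N by rewrite (dvdn_pcharf pF) card_natr0.
have [a a_prim] := exists_generator F.
pose N := if odd q then q./2 else q.-1.
pose M := if odd q then q./2.+1 else q.+1.
have Eq := odd_double_half q.
have dvN : (q.-1 %| 2 * N)%N.
  rewrite /N; case: ifP Eq => qo; last by rewrite dvdn_mull.
  by move=> E; rewrite -[X in (X.-1 %| _)%N]E mul2n.
have dvM : (q.+1 %| 2 * (p * M))%N.
  rewrite mulnCA dvdn_mull // /M; case: ifP Eq => qo; last by rewrite dvdn_mull.
  by move=> E; rewrite -[X in (X.+1 %| _)%N]E mul2n doubleS.
have co : coprime N (p * M).
  rewrite coprimeMr coprime_sym prime_coprime //; apply/andP; split.
    apply/negP => pN; have := prime_gt1 p_pr; suff : (p %| 1)%N by rewrite dvdn1; lia.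
    move: pN; rewrite /N; case: ifP Eq => qo E pN.
      by rewrite -(dvdn_addl 1 (_ : p %| q./2.*2)%N) ?E // -mul2n dvdn_mull.
    by rewrite -(dvdn_addl 1 pN) add1n prednK //; lia.
  rewrite /N /M; case: ifP Eq => qo E; first exact: coprimenS.
  have -> : (q.+1 = q.-1 + 2)%N by lia.
  rewrite /coprime gcdnDl -/(coprime _ 2) coprimen2 -subn1 oddB ?qo //.
  exact: leq_trans q8.
have [X1 [Y1 T1]] := exists_split_triple q8 q9 a_prim dvN.
have [s [X2 [Y2 T2]]] := exists_nonsplit_triple q8 q9 pF dvM (dvdn_mulr _ (dvdnn p)).
apply: (admits_of_gen_triples co T1 T2); apply: gl2_det_eq.
rewrite !val_gl2 ?det_mat2; first by ring.
  by rewrite mulr0 subr0 mulrN1 oppr_eq0 oner_neq0.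
by rewrite mul0r sub0r mulr1 oppr_eq0 oner_neq0.
Qed.

Lemma admits_seven : q = 7%N -> admits_strongly_real_beauville (L2 F).
Proof.
move=> q7; have [X1 [Y1 T1]] := gen_triple_777 q7.
have [X2 [Y2 T2]] := gen_triple_444_mod7 q7.
apply: (admits_of_gen_triples _ T1 T2) => //; apply: gl2_det_eq.
by rewrite !val_gl2 ?det_mat2; rewrite ?mulr0 ?mulr1 ?subr0 ?mulrN1 ?oppr_eq0 ?oner_neq0.
Qed.

Lemma admits_nine : q = 9%N -> admits_strongly_real_beauville (L2 F).
Proof.
move=> q9; have [a [aa a_prim]] := exists_sqr_1sub q9.
have [X1 [Y1 T1]] := gen_triple_444_mod9 q9 aa a_prim.
have [X2 [Y2 T2]] := gen_triple_555_mod9 q9 aa.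
apply: (admits_of_gen_triples _ T1 T2) => //; apply: gl2_det_eq.
rewrite !val_gl2 ?det_mat2.
- by apply: (eq_mod3 q9 (c := 1)); ring: aa.
- by apply: (neq0_mod3 q9 (y := - 1 - a) (c := 1 + a)); ring: aa.
- by apply: (neq0_mod3 q9 (y := - 1 - a) (c := 0)); ring: aa.
Qed.

End LargeFields.

Local Close Scope ring_scope.

Theorem theorem3p1 (q : nat)
    (hq : exists p k : nat, [/\ prime p, 0 < k & q = p ^ k])
    (F : finFieldType) (hF : #|F| = q) :
  admits_strongly_real_beauville (L2 F) <-> 5 < q.
Proof.
rewrite -hF; split=> [[x1 [y1 [z1 [x2 [y2 [z2 [B _]]]]]]]|].
  by rewrite ltnNge; apply/negP => q5; exact: not_beauville_small q5 _ _ _ _ _ _ B.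
move=> q6; have [q7|q7] := eqVneq #|F| 7; first exact: admits_seven.
have [q9|q9] := eqVneq #|F| 9; first exact: admits_nine.
apply: admits_generic; last exact/eqP.
suff : #|F| != 6 by lia.
have [p p_pr /pnat_card] := finPcharP F; apply: contraTneq => ->.
by rewrite /pnat /= !inE; apply/negP => /and3P[/eqP <-].
Qed.
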